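(* Let $X$ be a Noetherian topological space. Then every set $Y$ of transfinite words on $X$, equipped with the regular subword topology, is a Noetherian space. Moreover, for every bound $\alpha$, the irreducible closed subsets of $X^{<\alpha}$ (with the regular subword topology) are exactly the $\alpha$-products on $X$.
   Context: A topological space is Noetherian if every open subset is compact (no separation required); equivalently, its closed subsets are well-founded under inclusion. A closed set $C$ is irreducible if $C\neq\emptyset$ and whenever $C\subseteq F_1\cup F_2$ with $F_1,F_2$ closed, $C\subseteq F_1$ or $C\subseteq F_2$. A transfinite word $w$ on a set $X$ is a map from an ordinal $|w|$ (its length) to $X$; the empty word is $\epsilon$. For $F\subseteq X$ and an ordinal $\gamma$, $F^{<\gamma}$ is the set of transfinite words of length $<\gamma$ all of whose letters are in $F$. The concatenation $ww'$ has length $|w|+|w'|$, and for sets of words $AB=\{ww'\mid w\in A,\ w'\in B\}$; the empty product is $\{\epsilon\}$. The regular subword topology on a set $Y$ of transfinite words on a space $X$ is the coarsest topology on $Y$ making all the sets $(F_1^{<\alpha_1}F_2^{<\alpha_2}\cdots F_n^{<\alpha_n})\cap Y$ closed, where $n\in\mathbb N$, $F_1,\dots,F_n$ are closed in $X$ and $\alpha_1,\dots,\alpha_n$ are ordinals. A bound is an ordinal of the form $\omega^\beta$ or $\omega^\beta+1$ with $\beta\ge 0$; it is non-trivial if it differs from $\omega^0=1$. An ordinal is indecomposable if it is of the form $\omega^\beta$, and decomposable otherwise. An atom is a set $F^{<\gamma}$ with $F$ closed in $X$ and $\gamma$ a non-trivial bound, where $F$ is required to be irreducible closed if $\gamma=\omega^0+1$.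 A transfinite product is a finite (possibly empty) concatenation product of atoms. For a bound $\alpha$, an $\alpha$-product is a transfinite product $F_1^{<\gamma_1}\cdots F_n^{<\gamma_n}$ ($n\in\mathbb N$, each $F_i^{<\gamma_i}$ an atom) such that $\gamma_i\le\alpha$ and $F_i\ne\emptyset$ for every $i$, and, if $\alpha$ is decomposable, $\gamma_i<\alpha$ for every $i$ with $1\le i<n$. *)

(* Defs.v *)
From HB Require Import structures.
From mathcomp Require Import all_boot all_order.
From mathcomp Require Import generic_quotient.
From mathcomp Require Import all_classical topology.

Set Implicit Arguments.
Unset Strict Implicit.
Unset Printing Implicit Defensive.

Import Order.TTheory.
Local Open Scope classical_set_scope.
Local Open Scope quotient_scope.
Local Open Scope order_scope.

(* Well-founded trees, read as ordinals: [ONode f] stands for the least ordinal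
   strictly above all the [f a]. The type [Ord] below identifies trees of equal
   rank; [Ord_wf], [Ord_sup] and its total order make it the class of all
   ordinals (relative to the universe of [A]). *)
Inductive otree : Type := ONode (A : Type) of (A -> otree).

HB.instance Definition _ := gen_eqMixin otree.
HB.instance Definition _ := gen_choiceMixin otree.

Fixpoint tle (x y : otree) : Prop :=
  match x, y with
  | ONode A f, ONode B g => forall a : A, exists b : B, tle (f a) (g b)
  end.

Definition tlt (x y : otree) : Prop :=
  match y with ONode B g => exists b : B, tle x (g b) end.

Lemma tle_refl x : tle x x.
Proof. by elim: x => A f IH a; exists a; exact: IH. Qed.

Lemma tle_trans y x z : tle x y -> tle y z -> tle x z.
Proof.
elim: x y z => A f IH [B g] [C h] /= xy yz a.
have [b ab] := xy a; have [c bc] := yz b.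
by exists c; exact: (IH a _ _ ab bc).
Qed.

Lemma tltP x y : tlt x y <-> ~ tle y x.
Proof.
suff H z : (forall y, ~ tle y z -> tlt z y) /\ (forall y, tlt z y -> ~ tle y z).
  by have [H1 H2] := H x; split => [/H2|/H1].
elim: z => A f IH; split => -[B g] /=.
  move=> /existsNP[b /forallNP nb]; exists b.
  case E: (g b) => [C h] /= a.
  have [+ _] := IH a => /(_ (g b) (nb a)).
  by rewrite E.
case=> b xb /(_ b)[a ba].
have [_ /(_ (g b))] := IH a; apply => //.
case: (g b) xb => C h /= /(_ a) [c ac]; by exists c.
Qed.

Lemma tltW x y : tlt x y -> tle x y.
Proof.
elim: x y => A f IH [B g] /= [b].
case E: (g b) => [C h] /= H a; exists b.
by apply: IH; rewrite E; exact: H.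
Qed.

Lemma tle_total x y : tle x y \/ tle y x.
Proof.
have [|/tltP/tltW] := pselect (tle x y); by [left|right].
Qed.

Definition teqv : rel otree := fun x y => `[< tle x y /\ tle y x >].

Lemma teqv_refl : reflexive teqv.
Proof. by move=> x; apply/asboolP; split; exact: tle_refl. Qed.

Lemma teqv_sym : symmetric teqv.
Proof. by move=> x y; apply/asboolP/asboolP => -[]. Qed.

Lemma teqv_trans : transitive teqv.
Proof.
move=> y x z /asboolP[xy yx] /asboolP[yz zy]; apply/asboolP.
by split; [exact: tle_trans yz|exact: tle_trans yx].
Qed.

Canonical teqv_equiv := EquivRel teqv teqv_refl teqv_sym teqv_trans.

Definition Ord : Type := {eq_quot teqv}.

HB.instance Definition _ := Choice.on Ord.
HB.instance Definition _ := EqQuotient.on Ord.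

Definition ole (a b : Ord) : bool := `[< tle (repr a) (repr b) >].

Lemma tle_repr_pi x : tle (repr (\pi_Ord x)) x /\ tle x (repr (\pi_Ord x)).
Proof. by have /eqmodP/asboolP := reprK (\pi_Ord x). Qed.

Lemma ole_refl : reflexive ole.
Proof. by move=> a; apply/asboolP; exact: tle_refl. Qed.

Lemma ole_anti : antisymmetric ole.
Proof.
move=> a b /andP[/asboolP ab /asboolP ba].
by rewrite -(reprK a) -(reprK b); apply/eqmodP/asboolP.
Qed.

Lemma ole_trans : transitive ole.
Proof.
by move=> b a c /asboolP ab /asboolP bc; apply/asboolP; exact: tle_trans bc.
Qed.

Lemma ole_total : total ole.
Proof.
by move=> a b; apply/orP; have [h|h] := tle_total (repr a) (repr b);
  [left|right]; apply/asboolP.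
Qed.

Fact Ord_display : Order.disp_t. Proof. exact: Order.Disp tt tt. Qed.

HB.instance Definition _ :=
  Order.Le_isPOrder.Build Ord_display Ord ole_refl ole_anti ole_trans.
HB.instance Definition _ :=
  Order.POrder_isTotal.Build Ord_display Ord ole_total.

Lemma leo_pi x y : \pi_Ord x <= \pi_Ord y <-> tle x y.
Proof.
have [x1 x2] := tle_repr_pi x; have [y1 y2] := tle_repr_pi y.
split => [/asboolP h|h].
  exact: tle_trans x2 (tle_trans h y1).
by apply/asboolP; exact: tle_trans x1 (tle_trans h y2).
Qed.

Lemma lto_pi x y : \pi_Ord x < \pi_Ord y <-> tlt x y.
Proof.
rewrite ltNge; split => [/negP h|/tltP h].
  by apply/tltP => /leo_pi.
by apply/negP => /leo_pi.
Qed.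

Lemma eqo_pi x y : tle x y -> tle y x -> \pi_Ord x = \pi_Ord y.
Proof. by move=> xy yx; apply/eqmodP/asboolP. Qed.

Lemma Ord_wf : well_founded (fun a b : Ord => a < b).
Proof.
suff H x y : tle y x -> Acc (fun a b : Ord => a < b) (\pi_Ord y).
  by move=> a; rewrite -(reprK a); exact: H (tle_refl _).
elim: x y => A f IH y yx; constructor => c.
rewrite -(reprK c) => /lto_pi cy.
have [a ca] : tlt (repr c) (ONode f).
  by apply/tltP => h; move/tltP: cy; apply; exact: tle_trans h.
exact: IH a _ ca.
Qed.

Lemma Ord_sup (A : Type) (f : A -> Ord) :
  exists s : Ord, forall d, d < s <-> exists a, d <= f a.
Proof.
exists (\pi_Ord (ONode (fun a => repr (f a)))) => d.
rewrite -(reprK d); split => [/lto_pi[a h]|[a]]; last first.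
  by rewrite -(reprK (f a)) => /leo_pi h; apply/lto_pi; exists a.
by exists a; rewrite -(reprK (f a)); apply/leo_pi.
Qed.

Definition tzero : otree := ONode (fun v : void => match v with end).

Definition tsucc (x : otree) : otree := ONode (fun _ : unit => x).

(* x + y is the least ordinal strictly above every x' < x and every x + y' with
   y' < y. *)
Fixpoint tadd (x y : otree) : otree :=
  match x, y with
  | ONode A f, ONode B g =>
      ONode (fun s : A + B =>
        match s with inl a => f a | inr b => tadd x (g b) end)
  end.

(* omega^y is the least ordinal strictly above 0 and every omega^y' * n with
   y' < y and n finite: see also [lt_oomega]. *)
Fixpoint tomega (y : otree) : otree :=
  match y with
  | ONode B g =>
      ONode (fun s : option (B * nat) =>
        match s with
        | None => tzero
        | Some (b, n) => iter n (fun z => tadd z (tomega (g b))) tzero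
        end)
  end.

Lemma tle_tadd x x' y y' :
  tle x x' -> tle y y' -> tle (tadd x y) (tadd x' y').
Proof.
move=> xx'; elim: y y' => B g IH [B' g'] yy'.
case: x x' xx' IH => A f [A' f'] xx' IH [a|b].
  by have [a' h] := xx' a; exists (inl a').
by have [b' h] := yy' b; exists (inr b'); exact: IH.
Qed.

Lemma tlt_tadd d x y :
  tlt d (tadd x y) <-> tlt d x \/ exists2 z, tlt z y & tle d (tadd x z).
Proof.
case: y => B g; split.
  case: x => A f [[a|b] h]; first by left; exists a.
  by right; exists (g b) => //; exists b; exact: tle_refl.
case=> [|[z [b zb] dz]].
  by case: x => A f [a h]; exists (inl a).
have := tle_trans dz (tle_tadd (tle_refl x) zb).
by case: x {dz} => A f h; exists (inr b).
Qed.

Lemma tle_iter n x x' : tle x x' ->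
  tle (iter n (fun z => tadd z x) tzero) (iter n (fun z => tadd z x') tzero).
Proof.
move=> xx'; elim: n => [|n IH]; first exact: tle_refl.
exact: tle_tadd.
Qed.

Lemma tle_tomega y y' : tle y y' -> tle (tomega y) (tomega y').
Proof.
elim: y y' => B g IH [B' g'] yy' [[b n]|]; last by exists None => -[].
by have [b' h] := yy' b; exists (Some (b', n)); apply: tle_iter; exact: IH.
Qed.

Lemma tlt_tomega d y : tlt d (tomega y) <->
  tle d tzero \/ exists2 z, tlt z y &
    exists n, tle d (iter n (fun u => tadd u (tomega z)) tzero).
Proof.
case: y => B g; split.
  case=> -[[b n]|] h; [right|by left].
  by exists (g b); [exists b; exact: tle_refl|exists n].
case=> [h|[z [b zb] [n h]]]; first by exists None.
exists (Some (b, n)); apply: tle_trans h _.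
by apply: tle_iter; exact: tle_tomega.
Qed.

Definition ozero : Ord := \pi_Ord tzero.
Definition osucc (a : Ord) : Ord := \pi_Ord (tsucc (repr a)).
Definition oadd (a b : Ord) : Ord := \pi_Ord (tadd (repr a) (repr b)).
Definition oomega (b : Ord) : Ord := \pi_Ord (tomega (repr b)).

Lemma oadd_pi x y : oadd (\pi_Ord x) (\pi_Ord y) = \pi_Ord (tadd x y).
Proof.
have [x1 x2] := tle_repr_pi x; have [y1 y2] := tle_repr_pi y.
by apply: eqo_pi; exact: tle_tadd.
Qed.

Lemma oomega_pi y : oomega (\pi_Ord y) = \pi_Ord (tomega y).
Proof.
have [y1 y2] := tle_repr_pi y.
by apply: eqo_pi; exact: tle_tomega.
Qed.

Lemma le0o (a : Ord) : ozero <= a.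
Proof.
by rewrite -(reprK a); apply/leo_pi; case: (repr a) => A f [].
Qed.

Lemma lto0 (a : Ord) : (a < ozero) = false.
Proof. by rewrite ltNge le0o. Qed.

Lemma lt_osucc (a b : Ord) : (a < osucc b) = (a <= b).
Proof.
rewrite -(reprK a); apply/idP/idP => [/lto_pi[_ h]|h].
  by rewrite -(reprK b); apply/leo_pi.
by apply/lto_pi; exists tt; apply/leo_pi; rewrite (reprK b).
Qed.

Lemma lt_oadd (d a b : Ord) :
  d < oadd a b <-> d < a \/ exists2 c, c < b & d <= oadd a c.
Proof.
rewrite -(reprK d) -(reprK a) -(reprK b) oadd_pi.
split=> [/lto_pi/tlt_tadd[h|[z zb dz]]|[/lto_pi h|[c]]].
- by left; exact/lto_pi.
- by right; exists (\pi_Ord z); [exact/lto_pi|rewrite oadd_pi; exact/leo_pi].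
- by apply/lto_pi/tlt_tadd; left.
- rewrite -(reprK c) oadd_pi => /lto_pi cb /leo_pi dc.
  by apply/lto_pi/tlt_tadd; right; exists (repr c).
Qed.

Lemma lt_oomega (d b : Ord) : d < oomega b <->
  d = ozero \/ exists2 c, c < b &
    exists n, d <= iter n (fun e => oadd e (oomega c)) ozero.
Proof.
have iter_pi n z : iter n (fun e => oadd e (oomega (\pi_Ord z))) ozero =
    \pi_Ord (iter n (fun u => tadd u (tomega z)) tzero).
  by elim: n => //= n ->; rewrite oomega_pi oadd_pi.
rewrite -(reprK d) -(reprK b) oomega_pi.
split=> [/lto_pi/tlt_tomega[h|[z zb [n h]]]|[h|[c]]].
- by left; apply: eqo_pi => //; apply/leo_pi; exact: le0o.
- right; exists (\pi_Ord z); first exact/lto_pi.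
  by exists n; rewrite iter_pi; exact/leo_pi.
- by apply/lto_pi/tlt_tomega; left; apply/leo_pi; rewrite h.
- rewrite -(reprK c) => /lto_pi cb [n]; rewrite iter_pi => /leo_pi h.
  by apply/lto_pi/tlt_tomega; right; exists (repr c) => //; exists n.
Qed.

Lemma oadd_ltl (a b c : Ord) : c < b -> oadd a c < oadd a b.
Proof. by move=> cb; apply/lt_oadd; right; exists c. Qed.

Lemma oadd_inj (a : Ord) : injective (oadd a).
Proof.
move=> b c e; have [h|h|//] := ltgtP b c;
  by have := oadd_ltl a h; rewrite e ltxx.
Qed.

Lemma leo_addl (a b : Ord) : a <= oadd a b.
Proof.
rewrite leNgt; apply/negP => h.
have /lt_oadd : oadd a b < oadd a b by apply/lt_oadd; left.
by move=> _; have := ltxx (oadd a b); rewrite (proj2 (lt_oadd _ _ _) (or_introl h)).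
Qed.

Lemma oadd_diff (a b d : Ord) : a <= d -> d < oadd a b ->
  exists2 c : Ord, c < b & d = oadd a c.
Proof.
move=> ad; elim/(well_founded_induction Ord_wf): b => b IH /lt_oadd[|[c cb]].
  by rewrite ltNge ad.
rewrite le_eqVlt => /orP[/eqP ->|/IH]; first by exists c.
by case=> // e ec ->; exists e => //; exact: lt_trans cb.
Qed.

Definition below (a : Ord) : Type := {o : Ord | o < a}.

Lemma below_ozero : below ozero -> False.
Proof. by case=> o; rewrite lto0. Qed.

Record word (X : Type) := Word { wlen : Ord; wlet : below wlen -> X }.

HB.instance Definition _ (X : Type) := gen_eqMixin (word X).
HB.instance Definition _ (X : Type) := gen_choiceMixin (word X).

Section Words.
Variable X : Type.
Implicit Types (u v w : word X) (A B : set (word X)).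

Definition wempty : word X :=
  Word (fun i : below ozero => False_rect X (below_ozero i)).

(* A position o >= |u| of uv is |u| + o' for a position o' of v: see also
   [wcat_letl] and [wcat_letr]. *)
Definition wshift u v (i : below (oadd (wlen u) (wlen v)))
    (h : wlen u <= sval i) : below (wlen v) :=
  let c := cid2 (oadd_diff h (svalP i)) in exist _ (s2val c) (s2valP c).

Definition wcat u v : word X :=
  Word (fun i : below (oadd (wlen u) (wlen v)) =>
    match ltP (sval i) (wlen u) with
    | Order.LtlNotGe h => wlet (exist _ (sval i) h)
    | Order.GelNotLt h => wlet (wshift h)
    end).

Lemma wcat_letl u v (i : below (wlen (wcat u v))) (j : below (wlen u)) :
  sval i = sval j -> wlet i = wlet j.
Proof.
case: i j => i hi [j hj] /= ij; subst j.
case: ltP => [h|h]; last by exfalso; move: h; rewrite leNgt hj.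
by rewrite (bool_irrelevance h hj).
Qed.

Lemma wcat_letr u v (i : below (wlen (wcat u v))) (j : below (wlen v)) :
  sval i = oadd (wlen u) (sval j) -> wlet i = wlet j.
Proof.
case: i j => i hi [j hj] /= ij; subst i.
case: ltP => h; first by exfalso; move: h; rewrite ltNge leo_addl.
rewrite /wshift; case: cid2 => c /= hc e.
have ec := oadd_inj e; subst c.
by congr wlet; apply: val_inj.
Qed.

Definition words_lt (F : set X) (a : Ord) : set (word X) :=
  [set w | wlen w < a /\ forall i : below (wlen w), F (wlet i)].

Definition cat_set A B : set (word X) :=
  [set w | exists u v, [/\ A u, B v & w = wcat u v]].

Definition words_prod (n : nat) (F : 'I_n -> set X) (a : 'I_n -> Ord) :
    set (word X) :=
  \big[cat_set/[set wempty]]_(i < n) words_lt (F i) (a i).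

End Words.

Definition noetherian (T : topologicalType) : Prop :=
  forall U : set T, open U -> compact U.

Definition irreducible_closed (T : topologicalType) (C : set T) : Prop :=
  [/\ closed C, C !=set0 &
    forall F1 F2 : set T, closed F1 -> closed F2 -> C `<=` F1 `|` F2 ->
      C `<=` F1 \/ C `<=` F2].

(* An alias, to keep this topology apart from the library's instance on
   [set_type], which is the subspace topology. *)
Definition regular_subword (X : topologicalType) (Y : set (word X)) : Type :=
  set_type Y.

Section RegularSubword.
Variables (X : topologicalType) (Y : set (word X)).
Local Notation S := (regular_subword Y).

(* The subbase of open sets consists of the complements in Y of the sets
   F_1^{<a_1} ... F_n^{<a_n} that are to be closed. *)
Definition regular_subbase : set (set S) :=
  [set U | exists n (F : 'I_n -> set X) (a : 'I_n -> Ord),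
    (forall i, closed (F i)) /\
    U = ~` [set w : S | words_prod F a (\val w)]].

HB.instance Definition _ := Choice.on S.
HB.instance Definition _ := isSubBaseTopological.Build S regular_subbase id.

End RegularSubword.

Definition indecomposable (a : Ord) : Prop := exists b, a = oomega b.

Definition is_bound (a : Ord) : Prop :=
  exists b, a = oomega b \/ a = osucc (oomega b).

Definition nontrivial_bound (a : Ord) : Prop :=
  is_bound a /\ a <> oomega ozero.

(* Being an atom is a property of the presentation (F, a), not of the set of
   words F^{<a}. *)
Definition is_atom (X : topologicalType) (F : set X) (a : Ord) : Prop :=
  [/\ closed F, nontrivial_bound a &
    a = osucc (oomega ozero) -> irreducible_closed F].

Definition alpha_product (X : topologicalType) (alpha : Ord)
    (P : set (word X)) : Prop :=
  exists n (F : 'I_n -> set X) (g : 'I_n -> Ord),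
    [/\ forall i, is_atom (F i) (g i),
        forall i, g i <= alpha /\ F i !=set0,
        ~ indecomposable alpha -> forall i : 'I_n, (i.+1 < n)%N -> g i < alpha &
        P = words_prod F g].

(* Main.v *)
(* Call F^{<g} good if it is an atom with F nonempty. Every subbasic closed set is
   a finite union of products of good atoms, and so is the intersection of two
   such products: compare the first factors of two factorizations of a word, and
   use that {(u, v) | uv in P} is a finite union of rectangles for every product
   P. The same rectangles reduce the irreducibility of products to that of single
   atoms; for F^{<omega^b + 1} with b > 0, the latter holds because a word of
   length omega^b in F, in which each of finitely many given letters occurs
   cofinally, lies in a product only through a factor that contains the atom.
   Primality of atoms also turns an inclusion of P in A_1 ... A_n into a
   decomposition P = P_1 ... P_n with P_i included in A_i, so that inclusion of
   products is dominated by a multiset-like ordering of their atoms and hence is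
   well founded. Noetherianity and the description of the irreducible closed sets
   follow by choosing minimal products. *)
Require Import Defs.
From mathcomp Require Import all_boot all_order finmap.
From mathcomp Require Import all_classical topology.

Set Implicit Arguments.
Unset Strict Implicit.
Unset Printing Implicit Defensive.

Import Order.TTheory.
Local Open Scope order_scope.
Local Open Scope classical_set_scope.

(** * Ordinal arithmetic and indecomposable ordinals *)

Lemma lto_induction (P : Ord -> Prop) :
  (forall a, (forall b, b < a -> P b) -> P a) -> forall a, P a.
Proof. by move=> H; apply: (well_founded_induction Ord_wf). Qed.

Lemma exists_least (P : Ord -> Prop) :
  (exists a, P a) -> exists2 a, P a & forall b, b < a -> ~ P b.
Proof.
case=> a; elim/lto_induction: a => a IH Pa.
have [[b [ba Pb]]|N] := pselect (exists b, b < a /\ P b); first exact: IH Pb.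
by exists a => // b ba Pb; apply: N; exists b.
Qed.

Lemma le_ltP (a b : Ord) : (forall d, d < a -> d < b) -> a <= b.
Proof. by move=> H; rewrite leNgt; apply/negP => /H; rewrite ltxx. Qed.

Lemma oadd0 (a : Ord) : oadd a ozero = a.
Proof.
apply/le_anti/andP; split; last exact: leo_addl.
by apply: le_ltP => d /lt_oadd[//|[c]]; rewrite lto0.
Qed.

Lemma oadd_lel (a b c : Ord) : b <= c -> oadd a b <= oadd a c.
Proof. by rewrite le_eqVlt => /orP[/eqP -> //|/(oadd_ltl a)/ltW]. Qed.

Lemma oadd_ler (a b c : Ord) : a <= b -> oadd a c <= oadd b c.
Proof.
elim/lto_induction: c => c IH ab.
apply: le_ltP => d /lt_oadd[da|[e ec de]]; apply/lt_oadd.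
  by left; exact: lt_le_trans ab.
by right; exists e => //; exact: le_trans (IH _ ec ab).
Qed.

Lemma leo_addr (a b : Ord) : b <= oadd a b.
Proof.
elim/lto_induction: b => b IH; apply: le_ltP => d db.
by apply/lt_oadd; right; exists d => //; exact: IH.
Qed.

Lemma o0add (a : Ord) : oadd ozero a = a.
Proof.
elim/lto_induction: a => a IH; apply/le_anti; rewrite leo_addr andbT.
apply: le_ltP => d /lt_oadd[|[c ca]]; first by rewrite lto0.
by rewrite IH // => /le_lt_trans; apply.
Qed.

Lemma oaddA (a b c : Ord) : oadd a (oadd b c) = oadd (oadd a b) c.
Proof.
elim/lto_induction: c => c IH; apply/le_anti/andP; split;
  apply: le_ltP => d /lt_oadd[h|[e eh de]].
- by apply/lt_oadd; left; exact: lt_le_trans (leo_addl _ _).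
- have [h|h] := ltP e b.
    by apply/lt_oadd; left; apply/lt_oadd; right; exists e.
  have [f fc ef] := oadd_diff h eh; subst e.
  by apply/lt_oadd; right; exists f => //; rewrite -IH.
- by apply: lt_le_trans h _; apply: oadd_lel; exact: leo_addl.
- by apply: (le_lt_trans de); rewrite -IH //; do 2 apply: oadd_ltl.
Qed.

Lemma ole_diff (a d : Ord) : a <= d -> exists c, d = oadd a c.
Proof.
move=> ad; have [|c _ ->] := @oadd_diff a (osucc d) d ad; last by exists c.
by apply: lt_le_trans (leo_addr _ _); rewrite lt_osucc.
Qed.

Lemma gt0o (a : Ord) : (ozero < a) = (a != ozero).
Proof. by rewrite lt_neqAle le0o andbT eq_sym. Qed.

Lemma oadd_eq0 (a b : Ord) : oadd a b = ozero -> a = ozero /\ b = ozero.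
Proof.
move=> e; split; apply/eqP; rewrite -[_ == _]negbK -gt0o -leNgt -e.
  exact: leo_addl.
exact: leo_addr.
Qed.

Lemma lto_succ (a : Ord) : a < osucc a. Proof. by rewrite lt_osucc. Qed.

Lemma oadd_succ (a b : Ord) : oadd a (osucc b) = osucc (oadd a b).
Proof.
apply/le_anti/andP; split; apply: le_ltP => d.
  rewrite lt_osucc => /lt_oadd[/ltW h|[c]]; first exact: le_trans (leo_addl _ _).
  by rewrite lt_osucc => cb dc; apply: le_trans dc _; exact: oadd_lel.
by rewrite lt_osucc => h; apply: le_lt_trans h (oadd_ltl _ (lto_succ b)).
Qed.

Lemma osucc_le (a b : Ord) : (osucc a <= b) = (a < b).
Proof. by rewrite leNgt lt_osucc -ltNge. Qed.

Lemma osucc_inj : injective osucc.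
Proof.
move=> a b e; apply/le_anti.
by rewrite -(lt_osucc a b) -e lto_succ -(lt_osucc b a) e lto_succ.
Qed.

Lemma oomega_gt0 (b : Ord) : ozero < oomega b.
Proof. by apply/lt_oomega; left. Qed.

Lemma oomega_lt (a b : Ord) : a < b -> oomega a < oomega b.
Proof.
by move=> ab; apply/lt_oomega; right; exists a => //; exists 1%N; rewrite /= o0add.
Qed.

Lemma oomega_le (a b : Ord) : a <= b -> oomega a <= oomega b.
Proof. by rewrite le_eqVlt => /orP[/eqP -> //|/oomega_lt/ltW]. Qed.

Lemma iter_oadd_le (a b : Ord) n : a <= b ->
  iter n (oadd^~ a) ozero <= iter n (oadd^~ b) ozero.
Proof.
move=> ab; elim: n => //= n IH.
exact: le_trans (oadd_ler _ IH) (oadd_lel _ ab).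
Qed.

Lemma iter_oaddD (a : Ord) m n :
  oadd (iter m (oadd^~ a) ozero) (iter n (oadd^~ a) ozero) =
  iter (n + m) (oadd^~ a) ozero.
Proof. by elim: n => [|n IH] /=; rewrite ?oadd0 // oaddA IH. Qed.

Lemma oomegaD (b c d : Ord) : c < oomega b -> d < oomega b -> oadd c d < oomega b.
Proof.
move=> /lt_oomega[->|[e eb [m cm]]]; first by rewrite o0add.
move=> /lt_oomega[->|[f fb [n dn]]].
  by rewrite oadd0; apply/lt_oomega; right; exists e => //; exists m.
apply/lt_oomega; right; exists (Order.max e f); first by rewrite gt_max eb.
exists (n + m)%N; rewrite -[X in _ <= X]iter_oaddD.
apply: le_trans (oadd_ler _ (le_trans cm _)) (oadd_lel _ (le_trans dn _)).
  by apply: iter_oadd_le; apply: oomega_le; rewrite le_max lexx.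
by apply: iter_oadd_le; apply: oomega_le; rewrite le_max lexx orbT.
Qed.

Lemma oadd_oomega (b c : Ord) : c < oomega b -> oadd c (oomega b) = oomega b.
Proof.
move=> cb; apply/le_anti; rewrite leo_addr andbT.
apply: le_ltP => d /lt_oadd[/lt_trans|[e eb de]]; first exact.
exact: le_lt_trans (oomegaD cb eb).
Qed.

Lemma leo_oomega (b : Ord) : b <= oomega b.
Proof.
elim/lto_induction: b => b IH; apply: le_ltP => c cb.
exact: le_lt_trans (IH c cb) (oomega_lt cb).
Qed.

Lemma oomega0 : oomega ozero = osucc ozero.
Proof.
apply/le_anti/andP; split; last by rewrite osucc_le oomega_gt0.
by apply: le_ltP => d /lt_oomega[->|[c]]; rewrite ?lto_succ // lto0.
Qed.

Lemma lt1o (a : Ord) : (a < osucc ozero) = (a == ozero).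
Proof. by rewrite lt_osucc -[a == _]negbK -gt0o -leNgt. Qed.

Lemma oomega_gt1 (b : Ord) : b != ozero -> osucc ozero < oomega b.
Proof. by rewrite -oomega0 -gt0o => /oomega_lt. Qed.

(** If [a] is closed under addition, let [b] be least with [a <= oomega b]. Were [a] smaller, it
    would be at most a finite multiple of some [oomega c] with [c < b]; but [oomega c < a] by
    minimality, so that multiple is below [a]. *)
Lemma ord_decompose (a : Ord) : ozero < a ->
  (exists b, a = oomega b) \/
  (exists c d, [/\ c < a, d < a, ozero < d & a = oadd c d]).
Proof.
move=> a0.
have [H|] := pselect (forall c d, c < a -> d < a -> oadd c d < a); last first.
  move=> /existsNP[c /existsNP[d]] /not_implyP[ca] /not_implyP[da cda].
  right.
  (* The given [d] may overshoot [a]; the exact summand [e <= d] takes its place. *)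
  have [|e ed ae] := @oadd_diff c (osucc d) a (ltW ca).
    by rewrite oadd_succ lt_osucc leNgt; apply/negP.
  exists c, e; split => //.
    by rewrite lt_osucc in ed; exact: le_lt_trans da.
  by rewrite gt0o; apply: contraPneq ca => e0; rewrite ae e0 oadd0 ltxx.
left.
have [b ab Hb] := @exists_least (fun b => a <= oomega b) (ex_intro _ a (leo_oomega a)).
exists b; apply/eqP; rewrite eq_le ab /= leNgt; apply/negP => /lt_oomega[e|].
  by rewrite e ltxx in a0.
case=> c cb [n an]; have := Hb c cb; move/negP; rewrite -ltNge => ca.
suff : a < a by rewrite ltxx.
apply: le_lt_trans an _.
by elim: n => //= n IH; exact: H.
Qed.

Lemma bound_gt0 a : is_bound a -> ozero < a.
Proof.
case=> b [] ->; first exact: oomega_gt0.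
exact: lt_trans (oomega_gt0 _) (lto_succ _).
Qed.

Lemma bound_min a b : is_bound a -> is_bound b -> is_bound (Order.min a b).
Proof. by move=> Ha Hb; case: leP. Qed.

(** * Transfinite words *)

Section WordTheory.
Variable X : Type.
Implicit Types (u v w : word X) (F : set X).

(** A relation on plain ordinals, so that letters of different words can be compared without
    transporting positions along equalities of lengths. *)
Definition wat w o x := exists h : o < wlen w, wlet (exist _ o h) = x.

Lemma wat_lt w o x : wat w o x -> o < wlen w. Proof. by case. Qed.

Lemma wat_exists w o : o < wlen w -> exists x, wat w o x.
Proof. by move=> h; exists (wlet (exist _ o h)), h. Qed.

Lemma wat_fun w o x y : wat w o x -> wat w o y -> x = y.
Proof. by case=> h <- [k <-]; rewrite (bool_irrelevance h k). Qed.

Lemma word_ext u v : wlen u = wlen v ->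
  (forall o x, wat u o x -> wat v o x) -> u = v.
Proof.
case: u v => l f [m g] /= e; subst m => H; congr Word.
apply: funext => -[o h].
have [k] : wat (Word g) o (f (exist _ o h)) by apply: H; exists h.
by move=> <- /=; rewrite (bool_irrelevance h k).
Qed.

Lemma wat_cat u v o x : wat (wcat u v) o x <->
  wat u o x \/ exists2 c, o = oadd (wlen u) c & wat v c x.
Proof.
split=> [[h]|].
  have [ou|uo] := ltP o (wlen u).
    by rewrite (@wcat_letl _ u v (exist _ o h) (exist _ o ou)) // => e; left; exists ou.
  have [c cv oc] := oadd_diff uo h.
  rewrite (@wcat_letr _ u v (exist _ o h) (exist _ c cv)) // => e.
  by right; exists c => //; exists cv.
case=> [[h e]|[c -> [h e]]].
  exists (lt_le_trans h (leo_addl _ _)).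
  by rewrite (@wcat_letl _ u v _ (exist _ o h)).
exists (oadd_ltl _ h).
by rewrite (@wcat_letr _ u v _ (exist _ c h)).
Qed.

Lemma wcatA u v w : wcat u (wcat v w) = wcat (wcat u v) w.
Proof.
apply: word_ext => [|o x]; first exact: oaddA.
move=> /wat_cat[h|[c oc /wat_cat[h|[d cd h]]]]; apply/wat_cat.
- by left; apply/wat_cat; left.
- by left; apply/wat_cat; right; exists c.
- by right; exists d => //; rewrite oc cd; exact: oaddA.
Qed.

Lemma wcatw0 u : wcat u (wempty X) = u.
Proof.
apply: word_ext => [|o x]; first exact: oadd0.
by move=> /wat_cat[//|[c _ /wat_lt]]; rewrite lto0.
Qed.

Lemma wcat0w u : wcat (wempty X) u = u.
Proof.
apply: word_ext => [|o x]; first exact: o0add.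
by move=> /wat_cat[/wat_lt|[c -> //]]; rewrite ?lto0 // o0add.
Qed.

Lemma wlen0 u : wlen u = ozero -> u = wempty X.
Proof. by move=> e; apply: word_ext => // o x /wat_lt; rewrite e lto0. Qed.

Lemma wcat_split w a b : wlen w = oadd a b ->
  exists u v, [/\ wlen u = a, wlen v = b & w = wcat u v].
Proof.
case: w => l f /= e; subst l.
pose u := Word (fun i : below a =>
  f (exist _ (sval i) (lt_le_trans (svalP i) (leo_addl a b)))).
pose v := Word (fun i : below b =>
  f (exist _ (oadd a (sval i)) (oadd_ltl a (svalP i)))).
exists u, v; split => //; apply: word_ext => // o x [h /= e].
have [oa|ao] := ltP o a; apply/wat_cat.
  left; exists oa; rewrite -e /=; congr f; exact: val_inj.
have [c cb oc] := oadd_diff ao h.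
right; exists c => //; exists cb; rewrite -e /=; congr f; exact: val_inj.
Qed.

Lemma wcat_inj u v u' v' : wlen u = wlen u' -> wcat u v = wcat u' v' ->
  u = u' /\ v = v'.
Proof.
move=> e E; split.
  apply: word_ext => // o x h.
  have /wat_cat[//|[c oc _]] : wat (wcat u' v') o x.
    by rewrite -E; apply/wat_cat; left.
  by move: (wat_lt h); rewrite oc e ltNge leo_addl.
apply: word_ext => [|o x h].
  apply: (@oadd_inj (wlen u)); rewrite {2}e.
  by have := congr1 (@wlen X) E.
have /wat_cat[/wat_lt|[c oc hc]] : wat (wcat u' v') (oadd (wlen u) o) x.
- by rewrite -E; apply/wat_cat; right; exists o.
- by rewrite e ltNge leo_addl.
- by move: oc; rewrite e => /oadd_inj ->.
Qed.

(** Cutting [u'] at position [wlen u] gives two factorizations with first parts of equal length,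
    which must agree. *)
Lemma wcat_levi u v u' v' : wcat u v = wcat u' v' -> wlen u <= wlen u' ->
  exists m, u' = wcat u m /\ v = wcat m v'.
Proof.
move=> E /ole_diff[c /wcat_split[u1 [m [l1 lm eu]]]].
exists m; move: E; rewrite eu -wcatA => /wcat_inj[//|<- ->].
by split.
Qed.

Definition letters w : set X := range (@wlet X w).

Lemma lettersP w x : letters w x <-> exists o, wat w o x.
Proof.
split=> [[[o h] _ <-]|[o [h <-]]]; first by exists o, h.
by exists (exist _ o h).
Qed.

Lemma letters_cat u v : letters (wcat u v) = letters u `|` letters v.
Proof.
apply/seteqP; split => x.
  move=> /lettersP[o /wat_cat[h|[c _ h]]]; [left|right];
    apply/lettersP; by [exists o|exists c].
case=> /lettersP[o h]; apply/lettersP.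
  by exists o; apply/wat_cat; left.
by exists (oadd (wlen u) o); apply/wat_cat; right; exists o.
Qed.

Lemma letters0 : letters (wempty X) = set0.
Proof. by rewrite -subset0 => x /lettersP[o /wat_lt]; rewrite lto0. Qed.

Lemma words_ltE F a w : words_lt F a w <-> wlen w < a /\ letters w `<=` F.
Proof.
split=> -[h H]; split => //.
  by move=> _ [i _ <-].
by move=> i; apply: H; exists i.
Qed.

Lemma words_lt_sub F G a b : F `<=` G -> a <= b -> words_lt F a `<=` words_lt G b.
Proof.
move=> FG ab w /words_ltE[l h]; apply/words_ltE.
by split; [exact: lt_le_trans l ab|exact: subset_trans FG].
Qed.

Lemma words_lt0 F a : ozero < a -> words_lt F a (wempty X).
Proof. by move=> h; apply/words_ltE; split; rewrite ?letters0. Qed.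

Lemma words_lt_catl F a u v : words_lt F a (wcat u v) -> words_lt F a u.
Proof.
move=> /words_ltE[/= l]; rewrite letters_cat subUset => -[h _].
by apply/words_ltE; split => //; exact: le_lt_trans (leo_addl _ _) l.
Qed.

Lemma words_lt_catr F a u v : words_lt F a (wcat u v) -> words_lt F a v.
Proof.
move=> /words_ltE[/= l]; rewrite letters_cat subUset => -[_ h].
by apply/words_ltE; split => //; exact: le_lt_trans (leo_addr _ _) l.
Qed.

Lemma words_lt_oomegaD F b u v : words_lt F (oomega b) u ->
  words_lt F (oomega b) v -> words_lt F (oomega b) (wcat u v).
Proof.
move=> /words_ltE[lu hu] /words_ltE[lv hv]; apply/words_ltE; split.
  exact: oomegaD.
by rewrite letters_cat subUset.
Qed.

Definition wfun (a : Ord) (f : Ord -> X) := Word (fun i : below a => f (sval i)).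

Lemma wat_wfun a f o x : wat (wfun a f) o x <-> o < a /\ f o = x.
Proof. by split=> [[h <-]//|[h <-]]; exists h. Qed.

Lemma letters_wfun a f F : (forall o, o < a -> F (f o)) -> letters (wfun a f) `<=` F.
Proof. by move=> H x /lettersP[o /wat_wfun[h <-]]; exact: H. Qed.

Lemma wfun1_in F a x : osucc ozero < a -> F x ->
  words_lt F a (wfun (osucc ozero) (fun=> x)).
Proof. by move=> a1 Fx; apply/words_ltE; split => //; exact: letters_wfun. Qed.

Lemma letters_wfun1 a x : ozero < a -> letters (wfun a (fun=> x)) = [set x].
Proof.
move=> a0; apply/seteqP; split; first exact: letters_wfun.
by move=> _ ->; apply/lettersP; exists ozero; apply/wat_wfun.
Qed.

End WordTheory.

(** * Words with cofinally occurring letters *)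

(** Every ordinal arises from a non-successor by [n] successor steps ([H]), with [n] unique ([U]);
    [p] reads off this [n]. *)
Lemma finite_part : exists p : Ord -> nat, forall o, p (osucc o) = (p o).+1.
Proof.
have H o : exists n, exists2 l, (forall c, l <> osucc c) & o = iter n osucc l.
  elim/lto_induction: o => o IH.
  have [[c e]|N] := pselect (exists c, o = osucc c).
    have [|n [l Hl cl]] := IH c; first by rewrite e lto_succ.
    by exists n.+1, l => //=; rewrite -cl.
  by exists 0%N, o => // c e; apply: N; exists c.
have U m n l l' : (forall c, l <> osucc c) -> (forall c, l' <> osucc c) ->
    iter m osucc l = iter n osucc l' -> m = n.
  move=> Hl Hl'; elim: m n => [|m IH] [|n] //=; first by move/Hl.
    by move/esym/Hl'.
  by move/osucc_inj/IH ->.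
have [p Hp] := choice H; exists p => o.
have [l Hl e] := Hp o; have [l' Hl' e'] := Hp (osucc o).
by apply: (U _ _ _ _ Hl' Hl); rewrite -e' /= -e.
Qed.

(* The word reads the letters of [s] periodically, according to the finite part
   of the position. *)
Lemma cofinal_word (X : eqType) (s : seq X) (F : set X) b :
  b != ozero -> F !=set0 -> (forall x, x \in s -> F x) ->
  exists y : word X, [/\ wlen y = oomega b, letters y `<=` F &
    forall x u v, x \in s -> y = wcat u v -> wlen u < oomega b -> letters v x].
Proof.
move=> b0 [x0 Fx0] sF; have [p Hp] := finite_part.
have pD o n : p (iter n osucc o) = (n + p o)%N by elim: n => //= n IH; rewrite Hp IH.
(* The default letter [x0] is read only when [s] is empty. *)
pose f o := nth x0 s (p o %% size s).
exists (wfun (oomega b) f); split => //.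
  apply: letters_wfun => o _; have [|h] := ltnP (p o %% size s) (size s).
    by move/(mem_nth x0)/sF.
  by rewrite /f nth_default.
move=> x u v xs e lu.
have s0 : (0 < size s)%N by case: (s) xs.
have lt_iter n o : o < oomega b -> iter n osucc o < oomega b.
  move=> ob; elim: n => //= n IH.
  by rewrite -[iter n _ _]oadd0 -oadd_succ; apply: oomegaD IH (oomega_gt1 b0).
pose k := index x s.
have ks : (k < size s)%N by rewrite index_mem.
(* Chosen so that [n + p (wlen u)], the finite part of the [n]-th successor of [wlen u], is
   [p (wlen u) * size s + k], hence [k] modulo [size s]. *)
pose n := (p (wlen u) * (size s).-1 + k)%N.
have : wat (wfun (oomega b) f) (iter n osucc (wlen u)) x.
  apply/wat_wfun; split; first exact: lt_iter.
  rewrite /f pD /n addnC addnA -mulnS prednK // modnMDl modn_small //.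
  exact: nth_index.
rewrite e => /wat_cat[h|[c _ h]].
  suff le_iter : wlen u <= iter n osucc (wlen u).
    by have := wat_lt h; rewrite ltNge le_iter.
  by elim: (n) => //= m /le_trans; apply; exact/ltW/lto_succ.
by apply/lettersP; exists c.
Qed.

(** * Products of atoms *)

Section Terms.
Variable X : topologicalType.
Implicit Types (A B : set X * Ord) (p q t : seq (set X * Ord)).
Implicit Types (ts : seq (seq (set X * Ord))) (u v w : word X).

Definition aset A : set (word X) := words_lt A.1 A.2.

Definition tprod t : set (word X) := \big[@cat_set X/[set wempty X]]_(A <- t) aset A.

Definition tunion ts : set (word X) := [set w | exists2 t, t \in ts & tprod t w].

(** Unlike [good_atom], this allows the bound 1, an empty base, and a reducible base with words of
    length at most one; such factors arise when products are split or intersected. *)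
Definition bound_atom A := closed A.1 /\ is_bound A.2.

Definition good_atom A := is_atom A.1 A.2 /\ A.1 !=set0.

Lemma good_bound A : good_atom A -> bound_atom A.
Proof. by move=> [[cA [bA _] _] _]. Qed.

Lemma tprod_nil : tprod [::] = [set wempty X].
Proof. by rewrite /tprod big_nil. Qed.

Lemma tprod_consP A t w : tprod (A :: t) w <->
  exists u v, [/\ aset A u, tprod t v & w = wcat u v].
Proof. by rewrite /tprod big_cons. Qed.

Lemma tprod1 A : tprod [:: A] = aset A.
Proof.
apply/seteqP; split => w.
  by move=> /tprod_consP[u [v []]] + + ->; rewrite tprod_nil => ? ->; rewrite wcatw0.
move=> h; apply/tprod_consP; exists w, (wempty X).
by rewrite tprod_nil wcatw0.
Qed.

Lemma tprod_cat p q w : tprod (p ++ q) w <->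
  exists u v, [/\ tprod p u, tprod q v & w = wcat u v].
Proof.
elim: p w => [|A p IH] w.
  rewrite tprod_nil; split=> [h|[u [v [-> h ->]]]]; last by rewrite wcat0w.
  by exists (wempty X), w; rewrite wcat0w.
split.
  move=> /tprod_consP[a [_ [Aa /IH[u [v [pu qv ->]]] ->]]].
  exists (wcat a u), v; rewrite wcatA; split => //.
  by apply/tprod_consP; exists a, u.
move=> [_ [v [/tprod_consP[a [u [Aa pu ->]]] qv ->]]].
apply/tprod_consP; exists a, (wcat u v); rewrite wcatA; split => //.
by apply/IH; exists u, v.
Qed.

Lemma tprod_cat_sub p p' q q' : tprod p `<=` tprod p' -> tprod q `<=` tprod q' ->
  tprod (p ++ q) `<=` tprod (p' ++ q').
Proof.
move=> pp qq w /tprod_cat[u [v [/pp hu /qq hv ->]]]; apply/tprod_cat.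
by exists u, v.
Qed.

Definition bterm t := forall A, A \in t -> bound_atom A.

Lemma bterm_cons A t : bterm (A :: t) <-> bound_atom A /\ bterm t.
Proof.
split=> [H|[HA Ht] B]; last by rewrite inE => /predU1P[->|/Ht].
by split=> [|B Bt]; apply: H; rewrite inE ?eqxx // Bt orbT.
Qed.

Lemma bterm1 A : bound_atom A -> bterm [:: A].
Proof. by move=> HA B; rewrite inE => /eqP ->. Qed.

Lemma aset0 A : bound_atom A -> aset A (wempty X).
Proof. by move=> [_ /bound_gt0]; exact: words_lt0. Qed.

Lemma tprod0 t : bterm t -> tprod t (wempty X).
Proof.
elim: t => [_|A t IH /bterm_cons[HA /IH ht]]; first by rewrite tprod_nil.
apply/tprod_consP; exists (wempty X), (wempty X); rewrite wcatw0.
by split => //; exact: aset0.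
Qed.

Lemma tprod_behead A t : bound_atom A -> tprod t `<=` tprod (A :: t).
Proof.
move=> HA w h; apply/tprod_consP; exists (wempty X), w; rewrite wcat0w.
by split => //; exact: aset0.
Qed.

Lemma tprod_head A t : bterm t -> aset A `<=` tprod (A :: t).
Proof.
move=> Ht w h; apply/tprod_consP; exists w, (wempty X); rewrite wcatw0.
by split => //; exact: tprod0.
Qed.

Lemma tprod_mem A t : bterm t -> A \in t -> aset A `<=` tprod t.
Proof.
elim: t => // B t IH /bterm_cons[HB Ht]; rewrite inE => /predU1P[->|At].
  exact: tprod_head.
exact: subset_trans (IH Ht At) (tprod_behead HB).
Qed.

(** The prefix [u] either ends inside the first factor or covers it; atoms are closed under
    prefixes, and the remaining factors contain the empty word. *)
Lemma tprod_catl t u v : bterm t -> tprod t (wcat u v) -> tprod t u.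
Proof.
elim: t u v => [|A t IH] u v.
  rewrite tprod_nil => _ /(congr1 (@wlen X)) /oadd_eq0[/wlen0 -> _] //.
move=> /bterm_cons[HA Ht] /tprod_consP[a [q [Aa tq e]]].
have [h|/ltW h] := leP (wlen u) (wlen a).
  have [m [ea _]] := wcat_levi e h.
  by apply: tprod_head => //; rewrite ea in Aa; exact: words_lt_catl Aa.
have [m [eu eq]] := wcat_levi (esym e) h; rewrite eq in tq.
by apply/tprod_consP; exists a, m; split => //; exact: IH tq.
Qed.

Lemma tprod_catr t u v : bterm t -> tprod t (wcat u v) -> tprod t v.
Proof.
elim: t u v => [|A t IH] u v.
  rewrite tprod_nil => _ /(congr1 (@wlen X)) /oadd_eq0[_ /wlen0 ->] //.
move=> /bterm_cons[HA Ht] /tprod_consP[a [q [Aa tq e]]].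
have [h|/ltW h] := leP (wlen u) (wlen a).
  have [m [ea ->]] := wcat_levi e h.
  apply/tprod_consP; exists m, q; split => //.
  by rewrite ea in Aa; exact: words_lt_catr Aa.
have [m [_ eq]] := wcat_levi (esym e) h; rewrite eq in tq.
exact: tprod_behead (IH _ _ Ht tq).
Qed.

Definition finite_union (K : set X * Ord -> Prop) (S : set (word X)) :=
  exists2 ts, (forall t A, t \in ts -> A \in t -> K A) & S = tunion ts.

Lemma finite_union_tprod (K : set X * Ord -> Prop) t :
  (forall A, A \in t -> K A) -> finite_union K (tprod t).
Proof.
move=> Ht; exists [:: t]; first by move=> _ A /[!inE] /eqP ->; exact: Ht.
apply/seteqP; split=> w; first by exists t; rewrite ?inE.
by move=> [_ /[!inE] /eqP ->].
Qed.

Lemma finite_union_big (K : set X * Ord -> Prop) (I : eqType) (s : seq I)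
    (P : I -> set (word X)) : (forall i, i \in s -> finite_union K (P i)) ->
  finite_union K [set w | exists2 i, i \in s & P i w].
Proof.
elim: s => [_|i s IH H].
  by exists [::] => //; apply/seteqP; split => w [].
have [ts1 K1 e1] := H i (mem_head _ _).
have [|ts2 K2 e2] := IH; first by move=> j js; apply: H; rewrite inE js orbT.
exists (ts1 ++ ts2) => [t A|].
  by rewrite mem_cat => /orP[/K1|/K2]; apply.
apply/seteqP; split => w.
  move=> [j]; rewrite inE => /predU1P[->|js].
    by rewrite e1 => -[t tt1 h]; exists t => //; rewrite mem_cat tt1.
  move=> h; have : [set w | exists2 i, i \in s & P i w] w by exists j.
  by rewrite e2 => -[t tt2 h']; exists t => //; rewrite mem_cat tt2 orbT.
move=> [t]; rewrite mem_cat => /orP[tt1|tt2] h.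
  by exists i; rewrite ?mem_head // e1; exists t.
have : tunion ts2 w by exists t.
by rewrite -e2 => -[j js hj]; exists j => //; rewrite inE js orbT.
Qed.

Lemma finite_unionU (K : set X * Ord -> Prop) S T :
  finite_union K S -> finite_union K T -> finite_union K (S `|` T).
Proof.
move=> HS HT.
have -> : S `|` T =
    [set w | exists2 b : bool, b \in [:: true; false] & (if b then S else T) w].
  apply/seteqP; split=> [w [h|h]|w [[] _ h]]; by [exists true|exists false|left|right].
by apply: finite_union_big => -[].
Qed.

Lemma finite_union_cons (K : set X * Ord -> Prop) A S :
  K A -> finite_union K S -> finite_union K (cat_set (aset A) S).
Proof.
move=> HA [ts Kts ->]; exists [seq A :: t | t <- ts].
  move=> _ B /mapP[t tts ->]; rewrite inE => /predU1P[-> //|]; exact: Kts.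
apply/seteqP; split => w.
  move=> [u [v [Au [t tts tv] ->]]]; exists (A :: t); first exact: map_f.
  by apply/tprod_consP; exists u, v.
move=> [_ /mapP[t tts ->] /tprod_consP[u [v [Au tv ->]]]].
by exists u, v; split => //; exists t.
Qed.

(** * Splitting a concatenation inside a product *)

Definition is_splits A (sp : seq ((set X * Ord) * (set X * Ord))) :=
  (forall pr, pr \in sp -> bound_atom pr.1 /\ bound_atom pr.2) /\
  forall u v, aset A (wcat u v) <-> exists2 pr, pr \in sp & aset pr.1 u /\ aset pr.2 v.

(** For exponent [oomega b] one rectangle suffices, by indecomposability. A word of length at most
    [oomega b] is cut either before position [oomega b] or so that the second part is empty;
    [(F, oomega ozero)] stands for the empty word alone. *)
Lemma splits_exist A : bound_atom A -> exists sp, is_splits A sp.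
Proof.
case: A => F g [/= cF [b [->|->]]].
  exists [:: ((F, oomega b), (F, oomega b))]; split.
    by move=> _ /[!inE] /eqP -> /=; split; split => //; exists b; left.
  move=> u v; split=> [h|[_ /[!inE] /eqP -> /= [hu hv]]].
    exists ((F, oomega b), (F, oomega b)); rewrite ?inE //.
    by split; [exact: words_lt_catl h|exact: words_lt_catr h].
  exact: words_lt_oomegaD.
exists [:: ((F, oomega b), (F, osucc (oomega b)));
           ((F, osucc (oomega b)), (F, oomega ozero))]; split.
  by move=> _ /[!inE] /orP[/eqP ->|/eqP ->] /=; split; split => //;
    [exists b; left|exists b; right|exists b; right|exists ozero; left].
move=> u v; split=> [/words_ltE[/=]|].
  rewrite lt_osucc letters_cat subUset => l [hu hv].
  have [ub|bu] := ltP (wlen u) (oomega b).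
    eexists; first exact: mem_head.
    split; apply/words_ltE; split => //=; rewrite lt_osucc.
    exact: le_trans (leo_addr _ _) l.
  exists ((F, osucc (oomega b)), (F, oomega ozero)); first by rewrite !inE eqxx orbT.
  have eu : wlen u = oomega b.
    by apply/le_anti; rewrite bu andbT; exact: le_trans (leo_addl _ _) l.
  split; apply/words_ltE; split => //=; first by rewrite eu lto_succ.
  rewrite oomega0 lt_osucc leNgt; apply/negP => /(oadd_ltl (wlen u)).
  by rewrite oadd0 => /lt_le_trans/(_ l); rewrite eu ltxx.
move=> [_ /[!inE] /orP[/eqP ->|/eqP ->]] /= [/words_ltE[/= lu hu] /words_ltE[/= lv hv]];
  apply/words_ltE; rewrite letters_cat subUset; split => //=; rewrite lt_osucc.
  apply: le_trans (oadd_lel _ _) _; first by rewrite lt_osucc in lv; exact: lv.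
  by rewrite oadd_oomega.
move: lv; rewrite oomega0 lt1o => /eqP ->.
by rewrite oadd0 -lt_osucc.
Qed.

Definition is_rects q (rs : seq (seq (set X * Ord) * seq (set X * Ord))) :=
  (forall pr, pr \in rs -> bterm pr.1 /\ bterm pr.2) /\
  forall u v, tprod q (wcat u v) <->
    exists2 pr, pr \in rs & tprod pr.1 u /\ tprod pr.2 v.

(** The first list is for cuts inside the factor [A], the second for cuts after it. *)
Definition rects_cons A (sp : seq ((set X * Ord) * (set X * Ord))) q
    (rs : seq (seq (set X * Ord) * seq (set X * Ord))) :=
  [seq ([:: pr.1], pr.2 :: q) | pr <- sp] ++ [seq (A :: pr.1, pr.2) | pr <- rs].

Lemma is_rects_cons A sp q rs : bound_atom A -> bterm q ->
  is_splits A sp -> is_rects q rs -> is_rects (A :: q) (rects_cons A sp q rs).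
Proof.
move=> HA Hq [Hsp sp_def] [Hrs rs_def]; split.
  move=> pr; rewrite mem_cat => /orP[/mapP[x /Hsp[h1 h2] ->]|/mapP[x /Hrs[h1 h2] ->]] /=.
    by split; [exact: bterm1|exact/bterm_cons].
  by split => //; exact/bterm_cons.
move=> u v; split.
  move=> /tprod_consP[a [r [Aa qr e]]].
  have [h|/ltW h] := leP (wlen u) (wlen a).
    have [m [ea ev]] := wcat_levi e h; rewrite ea in Aa.
    have [pr prs [h1 h2]] := (sp_def u m).1 Aa.
    exists ([:: pr.1], pr.2 :: q).
      by rewrite mem_cat; apply/orP; left; apply/mapP; exists pr.
    by rewrite tprod1; split => //; apply/tprod_consP; exists m, r.
  have [m [eu er]] := wcat_levi (esym e) h; rewrite er in qr.
  have [pr prs [h1 h2]] := (rs_def m v).1 qr.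
  exists (A :: pr.1, pr.2).
    by rewrite mem_cat; apply/orP; right; apply/mapP; exists pr.
  by split => //; apply/tprod_consP; exists a, m.
move=> [pr]; rewrite mem_cat => /orP[/mapP[x xs ->]|/mapP[x xs ->]] /=.
  rewrite tprod1 => -[h1 /tprod_consP[m [r [h2 qr ->]]]].
  rewrite wcatA; apply/tprod_consP; exists (wcat u m), r; split => //.
  by apply/sp_def; exists x.
move=> [/tprod_consP[a [m [Aa h1 ->]]] h2].
rewrite -wcatA; apply/tprod_consP; exists a, (wcat m v); split => //.
by apply/rs_def; exists x.
Qed.

Lemma rects_exist q : bterm q -> exists rs, is_rects q rs.
Proof.
elim: q => [_|A q IH /bterm_cons[HA Hq]].
  exists [:: ([::], [::])]; split; first by move=> _ /[!inE] /eqP ->.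
  move=> u v; rewrite tprod_nil; split=> [/(congr1 (@wlen X)) /oadd_eq0[hu hv]|].
    by exists ([::], [::]); rewrite ?inE //= tprod_nil; split; exact: wlen0.
  by move=> [_ /[!inE] /eqP ->] /=; rewrite tprod_nil => -[-> ->]; rewrite wcatw0.
have [sp Hsp] := splits_exist HA; have [rs Hrs] := IH Hq.
by exists (rects_cons A sp q rs); exact: is_rects_cons.
Qed.

(** * Intersections of products *)

Lemma bound_atomI A B : bound_atom A -> bound_atom B ->
  bound_atom (A.1 `&` B.1, Order.min A.2 B.2).
Proof. by move=> [? ?] [? ?]; split; [exact: closedI|exact: bound_min]. Qed.

Lemma asetI A B w :
  aset (A.1 `&` B.1, Order.min A.2 B.2) w <-> aset A w /\ aset B w.
Proof.
split=> [/words_ltE[/=]|[/words_ltE[lA hA] /words_ltE[lB hB]]].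
  rewrite lt_min subsetI => /andP[lA lB] [hA hB].
  by split; apply/words_ltE.
by apply/words_ltE; rewrite lt_min lA lB subsetI.
Qed.

(* The part of the intersection where the first factor [u] of [A :: q] is a
   prefix of the first factor of [A' :: q']. *)
Definition left_part A q (sp' : seq ((set X * Ord) * (set X * Ord))) q' :=
  [set w | exists2 pr, pr \in sp' &
    cat_set (aset (A.1 `&` pr.1.1, Order.min A.2 pr.1.2))
            (tprod q `&` tprod (pr.2 :: q')) w].

Lemma left_part_sub A q A' sp' q' : is_splits A' sp' ->
  left_part A q sp' q' `<=` tprod (A :: q) `&` tprod (A' :: q').
Proof.
move=> [_ Hsp] w [pr prs [u [v [/asetI[Au hu] [qv /tprod_consP[m [r [hm hr ev]]]] ->]]]].
split; first by apply/tprod_consP; exists u, v.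
rewrite ev wcatA; apply/tprod_consP; exists (wcat u m), r; split => //.
by apply/Hsp; exists pr.
Qed.

Lemma left_part_sup A q A' sp' q' u v u' v' : is_splits A' sp' ->
  aset A u -> tprod q v -> aset A' u' -> tprod q' v' -> wcat u v = wcat u' v' ->
  wlen u <= wlen u' -> left_part A q sp' q' (wcat u v).
Proof.
move=> [_ Hsp] Au qv Au' qv' e l.
have [m [eu ev]] := wcat_levi e l; rewrite eu in Au'.
have [pr prs [h1 h2]] := (Hsp u m).1 Au'.
exists pr => //; exists u, v; split => //; first exact/asetI.
by split => //; apply/tprod_consP; exists m, v'.
Qed.

(** Induction on the total number of factors: cutting at the end of the shorter of the two first
    factors of a word uses up one atom and leaves a remainder of the other, so one factor fewer is
    left to intersect. *)
Lemma tprodI p q : bterm p -> bterm q ->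
  finite_union bound_atom (tprod p `&` tprod q).
Proof.
have [n] := ubnP (size p + size q); elim: n p q => // n IH [|A p] [|B q] /=.
- by move=> *; rewrite setIid; exact: finite_union_tprod.
- move=> _ Hp Hq; rewrite setIidl; first exact: finite_union_tprod.
  by move=> w; rewrite tprod_nil => ->; exact: tprod0.
- move=> _ Hp Hq; rewrite setIidr; first exact: finite_union_tprod.
  by move=> w; rewrite tprod_nil => ->; exact: tprod0.
rewrite addSn addnS !ltnS => sn /bterm_cons[HA Hp] /bterm_cons[HB Hq].
have [sA HsA] := splits_exist HA; have [sB HsB] := splits_exist HB.
have -> : tprod (A :: p) `&` tprod (B :: q) = left_part A p sB q `|` left_part B q sA p.
  apply/seteqP; split => [w [/tprod_consP[u [v [Au pv ->]]]]|w [|]].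
  - move=> /tprod_consP[u' [v' [Bu qv e]]]; have [h|/ltW h] := leP (wlen u) (wlen u').
      by left; exact: (left_part_sup HsB Au pv Bu qv).
    by right; rewrite e; exact: (left_part_sup HsA Bu qv Au pv).
  - exact: left_part_sub.
  - by rewrite setIC; exact: left_part_sub.
apply: finite_unionU; apply: finite_union_big => pr prs; apply: finite_union_cons.
- by apply: bound_atomI => //; exact: (HsB.1 pr prs).1.
- apply: IH => //; first by rewrite /= addnS.
  by apply/bterm_cons; split => //; exact: (HsB.1 pr prs).2.
- by apply: bound_atomI => //; exact: (HsA.1 pr prs).1.
- apply: IH => //; first by rewrite /= addnS addnC.
  by apply/bterm_cons; split => //; exact: (HsA.1 pr prs).2.
Qed.

(** * Powers with arbitrary exponents *)

(** A word longer than [a] is cut at position [a]; any other is paired with the empty word, which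
    lies in the second factor as [b] is positive. *)
Lemma words_lt_oaddP (F : set X) a b w : ozero < b ->
  words_lt F (oadd a b) w <->
  cat_set (words_lt F (osucc a)) (words_lt F b) w.
Proof.
move=> b0; split.
  move=> /words_ltE[l h]; have [wa|/ltW aw] := leP (wlen w) a.
    exists w, (wempty X); rewrite wcatw0; split => //; last exact: words_lt0.
    by apply/words_ltE; rewrite lt_osucc.
  have [c cb e] := oadd_diff aw l.
  have [u [v [lu lv ew]]] := wcat_split e; exists u, v.
  move: h; rewrite ew letters_cat subUset => -[hu hv].
  by split => //; apply/words_ltE; rewrite ?lu ?lv ?lto_succ.
move=> [u [v [/words_ltE[lu hu] /words_ltE[lv hv] ->]]].
apply/words_ltE; rewrite letters_cat subUset; split => //=.
apply: lt_le_trans (oadd_ltl _ lv) (oadd_ler _ _).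
by rewrite -lt_osucc.
Qed.

Lemma words_lt_tprod (F : set X) a : closed F -> ozero < a ->
  exists2 t, bterm t & tprod t = words_lt F a.
Proof.
move=> cF a0.
(* The successor is carried along because F^{<c+d} is F^{<c+1} F^{<d} and F^{<c+d+1} is F^{<c+1}
   F^{<d+1}. *)
suff : (exists2 t, bterm t & tprod t = words_lt F a) /\
    (exists2 t, bterm t & tprod t = words_lt F (osucc a)) by case.
elim/lto_induction: a a0 => a IH a0.
have [[b ->]|[c [d [ca da d0 ->]]]] := ord_decompose a0.
  split; [exists [:: (F, oomega b)]|exists [:: (F, osucc (oomega b))]];
    by [apply: bterm1; split => //; exists b; by [left|right]|rewrite tprod1].
have [t1 Ht1 e1] : exists2 t, bterm t & tprod t = words_lt F (osucc c).
  have [->|c0] := eqVneq c ozero; last by case: (IH c) => //; rewrite gt0o.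
  exists [:: (F, oomega ozero)]; last by rewrite tprod1 -oomega0.
  by apply: bterm1; split => //; exists ozero; left.
have [[t2 Ht2 e2] [t3 Ht3 e3]] := IH d da d0.
have bterm_cat s t : bterm s -> bterm t -> bterm (s ++ t).
  by move=> Hs Ht A; rewrite mem_cat => /orP[/Hs|/Ht].
split; [exists (t1 ++ t2)|exists (t1 ++ t3)]; try exact: bterm_cat.
  apply/seteqP; split => w.
    move=> /tprod_cat[u [v []]]; rewrite e1 e2 => hu hv ->.
    by apply/(words_lt_oaddP _ _ _ d0); exists u, v.
  move=> /(words_lt_oaddP _ _ _ d0)[u [v [hu hv ->]]]; apply/tprod_cat.
  by exists u, v; rewrite e1 e2.
rewrite -oadd_succ; have s0 : ozero < osucc d by exact: lt_trans (lto_succ _).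
apply/seteqP; split => w.
  move=> /tprod_cat[u [v []]]; rewrite e1 e3 => hu hv ->.
  by apply/(words_lt_oaddP _ _ _ s0); exists u, v.
move=> /(words_lt_oaddP _ _ _ s0)[u [v [hu hv ->]]]; apply/tprod_cat.
by exists u, v; rewrite e1 e3.
Qed.

Lemma tprod_finite_union t : (forall A, A \in t -> closed A.1) ->
  finite_union bound_atom (tprod t).
Proof.
elim: t => [_|A t IH H]; first exact: finite_union_tprod.
have cA : closed A.1 by apply: H; exact: mem_head.
have [|ts Kts e] := IH; first by move=> B Bt; apply: H; rewrite inE Bt orbT.
(* With exponent 0 the factor has no word at all, not even the empty one, so the product is the
   empty union. *)
have [a0|a0] := eqVneq A.2 ozero.
  exists [::] => //; apply/seteqP; split => w; last by case.
  by move=> /tprod_consP[u [v [/words_ltE[]]]]; rewrite a0 lto0.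
have [|p Hp ep] := @words_lt_tprod A.1 A.2 cA; first by rewrite gt0o.
exists [seq p ++ s | s <- ts].
  move=> _ B /mapP[s ss ->]; rewrite mem_cat => /orP[/Hp //|]; exact: Kts.
apply/seteqP; split => w.
  move=> /tprod_consP[u [v [Au]]]; rewrite e => -[s ss sv] ->.
  exists (p ++ s); first exact: map_f.
  by apply/tprod_cat; exists u, v; rewrite ep.
move=> [_ /mapP[s ss ->]] /tprod_cat[u [v [+ hv ->]]]; rewrite ep => hu.
by apply/tprod_consP; exists u, v; split => //; rewrite e; exists s.
Qed.

(** * Primality of atoms and products *)

Lemma irreducible_seq (F : set X) (I : eqType) (s : seq I) (H : I -> set X) :
  irreducible_closed F -> (forall i, i \in s -> closed (H i)) ->
  F `<=` [set x | exists2 i, i \in s & H i x] -> exists2 i, i \in s & F `<=` H i.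
Proof.
move=> [_ [x0 Fx0] irrF].
have cl (r : seq I) : (forall i, i \in r -> closed (H i)) ->
    closed [set x | exists2 i, i \in r & H i x].
  elim: r => [_|i r IH cr].
    have -> : [set x | exists2 i, i \in [::] & H i x] = set0.
      by rewrite -subset0 => x [].
    exact: closed0.
  have -> : [set x | exists2 j, j \in i :: r & H j x] =
      H i `|` [set x | exists2 j, j \in r & H j x].
    apply/seteqP; split => x.
      by move=> [j]; rewrite inE => /predU1P[->|jr] h; [left|right; exists j].
    case=> [h|[j jr h]]; first by exists i => //; exact: mem_head.
    by exists j => //; rewrite inE jr orbT.
  apply: closedU; first by apply: cr; exact: mem_head.
  by apply: IH => j jr; apply: cr; rewrite inE jr orbT.
elim: s => [_ /(_ _ Fx0)[]//|i s IH cs sub].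
have [|||h|h] := irrF (H i) [set x | exists2 i, i \in s & H i x].
- by apply: cs; exact: mem_head.
- by apply: cl => j js; apply: cs; rewrite inE js orbT.
- move=> x /sub[j]; rewrite inE => /predU1P[->|js] h; [by left|right; by exists j].
- by exists i; rewrite ?mem_head.
have [|//|j js Fj] := IH; first by move=> j js; apply: cs; rewrite inE js orbT.
by exists j => //; rewrite inE js orbT.
Qed.

(** For [b] nonzero, choose a letter of [F] outside each member of [s] that does not contain [F],
    and repeat these letters cofinally. For [b] zero, irreducibility of [F] yields a single letter
    outside all those members. *)
Lemma generic_word (F : set X) b (s : seq (set X)) : F !=set0 ->
  (b = ozero -> irreducible_closed F) -> (forall H, H \in s -> closed H) ->
  exists y : word X, [/\ wlen y = oomega b, letters y `<=` F &
    forall H u v, H \in s -> y = wcat u v -> wlen u < oomega b ->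
      letters v `<=` H -> F `<=` H].
Proof.
move=> F0 irr cs.
pose s' := [seq H <- s | `[< ~ F `<=` H >]].
have [b0|b0] := eqVneq b ozero; last first.
  have [r rF rs] : exists2 r : seq X, (forall x, x \in r -> F x) &
      forall H, H \in s' -> exists2 x, x \in r & ~ H x.
    have: forall H, H \in s' -> ~ F `<=` H.
      by move=> H; rewrite mem_filter => /andP[/asboolP].
    elim: (s') => [_|H l IH Hl]; first by exists [::].
    have [|r rF rl] := IH; first by move=> K Kl; apply: Hl; rewrite inE Kl orbT.
    have /existsNP[x /not_implyP[Fx Hx]] := Hl H (mem_head _ _).
    exists (x :: r) => [y|K]; rewrite inE => /predU1P[-> //|]; first exact: rF.
      by exists x => //; exact: mem_head.
    by move=> /rl[y yr Ky]; exists y => //; rewrite inE yr orbT.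
  have [y [ly yF cof]] := cofinal_word b0 F0 rF; exists y; split => //.
  move=> H u v Hs e lu vH; apply: contrapT => nFH.
  have [|x xr nHx] := rs H; first by rewrite mem_filter Hs andbT; exact/asboolP.
  by apply: nHx; apply: vH; exact: cof xr e lu.
have [x [Fx nx]] : exists x, F x /\ forall H, H \in s' -> ~ H x.
  apply: contrapT => N.
  have [||H] := @irreducible_seq F _ s' id (irr b0).
  - by move=> H; rewrite mem_filter => /andP[_ /cs].
  - move=> x Fx; apply: contrapT => N2; apply: N; exists x; split => // H Hs Hx.
    by apply: N2; exists H.
  - by rewrite mem_filter => /andP[/asboolP].
exists (wfun (oomega b) (fun=> x)); split => //; first exact: letters_wfun.
move=> H u v Hs e; rewrite b0 oomega0 lt1o => /eqP/wlen0 u0.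
move: e; rewrite u0 wcat0w => <-; rewrite letters_wfun1 ?oomega_gt0 // => xH.
apply: contrapT => nFH; apply: (nx H); last exact: xH.
by rewrite mem_filter Hs andbT; exact/asboolP.
Qed.

(** Finitely many lengths below [oomega b] cannot add up to it, so some factor of [w] has length
    [oomega b]; the earlier ones make up [u] and the later ones are empty. *)
Lemma tprod_oomega_tail t w b : wlen w = oomega b -> tprod t w ->
  exists A u v, [/\ A \in t, w = wcat u v, wlen u < oomega b,
    wlen v = oomega b & aset A v].
Proof.
elim: t w => [|A t IH] w lw.
  by rewrite tprod_nil => w0; have := oomega_gt0 b; rewrite -lw w0 ltxx.
move=> /tprod_consP[a [q [Aa tq e]]].
have laq : oadd (wlen a) (wlen q) = oomega b by rewrite -lw e.
have [ab|ba] := ltP (wlen a) (oomega b).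
  have lq : wlen q = oomega b.
    by apply: (@oadd_inj (wlen a)); rewrite laq oadd_oomega.
  have [B [u [v [Bt eq lu lv Bv]]]] := IH q lq tq.
  exists B, (wcat a u), v; split => //; first by rewrite inE Bt orbT.
    by rewrite e eq wcatA.
  exact: oomegaD.
have la : wlen a = oomega b.
  by apply/le_anti; rewrite ba andbT -laq leo_addl.
have q0 : q = wempty X.
  by apply: wlen0; apply: (@oadd_inj (wlen a)); rewrite laq oadd0.
exists A, (wempty X), a; split => //; rewrite ?mem_head ?oomega_gt0 //.
by rewrite e q0 wcatw0 wcat0w.
Qed.

(** The atom even lies in a single factor. For exponent [oomega b], if no factor contains it,
    concatenating words outside the factors gives a word of the atom outside every product. For
    [osucc (oomega b)], a generic word of length [oomega b] is tested. *)
Lemma atom_prime B ts : good_atom B -> (forall t, t \in ts -> bterm t) ->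
  aset B `<=` tunion ts ->
  exists t A, [/\ t \in ts, A \in t & aset B `<=` aset A].
Proof.
case: B => G g [[/= cG [[b gb] g1] irrG] G0] Hts sub.
case: gb => gb; subst g.
  have b0 : b != ozero by apply: contra_notN g1 => /eqP ->.
  apply: contrapT => N.
  (* Take [x] outside [A] and [y] outside the product of the other factors. If [wcat x y] were in
     the whole product, either its first factor would have [x] as a prefix, or the rest would have
     [y] as a suffix. *)
  have avoid t : bterm t -> (forall A, A \in t -> ~ aset (G, oomega b) `<=` aset A) ->
      exists2 y, aset (G, oomega b) y & ~ tprod t y.
    elim: t => [_ _|A t IH /bterm_cons[HA Ht] H].
      have [x Gx] := G0; exists (wfun (osucc ozero) (fun=> x)).
        by apply: wfun1_in => //; exact: oomega_gt1.
      rewrite tprod_nil => /(congr1 (@wlen X)) /= e.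
      by have := lto_succ ozero; rewrite e ltxx.
    have [|y By nty] := IH Ht; first by move=> C Ct; apply: H; rewrite inE Ct orbT.
    have /existsNP[x /not_implyP[Bx nAx]] := H A (mem_head _ _).
    exists (wcat x y); first exact: words_lt_oomegaD.
    move=> /tprod_consP[a [q [Aa tq e]]].
    have [h|/ltW h] := leP (wlen x) (wlen a).
      by have [m [ea _]] := wcat_levi e h; apply: nAx; rewrite ea in Aa;
        exact: words_lt_catl Aa.
    have [m [_ eq]] := wcat_levi (esym e) h; apply: nty; rewrite eq in tq.
    exact: tprod_catr tq.
  suff [y By nty] : exists2 y, aset (G, oomega b) y & forall t, t \in ts -> ~ tprod t y.
    by have [t tts ty] := sub y By; exact: nty ty.
  have {}N t A : t \in ts -> A \in t -> ~ aset (G, oomega b) `<=` aset A.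
    by move=> tts At h; apply: N; exists t, A.
  elim: {sub} ts Hts N => [_ _|t ts IH Hts N].
    by exists (wempty X) => //; apply: words_lt0; exact: oomega_gt0.
  have [||y By ny] := IH.
  - by move=> s ss; apply: Hts; rewrite inE ss orbT.
  - by move=> s A ss; apply: N; rewrite inE ss orbT.
  have [||z Bz nz] := avoid t.
  - by apply: Hts; exact: mem_head.
  - by move=> A; apply: N; exact: mem_head.
  exists (wcat y z); first exact: words_lt_oomegaD.
  move=> s; rewrite inE => /predU1P[->|sts].
    by move=> /tprod_catr h; apply: nz; apply: h; apply: Hts; exact: mem_head.
  move=> /tprod_catl h; apply: (ny s) => //; apply: h; apply: Hts.
  by rewrite inE sts orbT.
(* The word is generic for the bases of all factors occurring in [ts]; a final segment of it, of
   length [oomega b], lies in a single factor. *)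
have [||y [ly yG gen]] := @generic_word G b [seq A.1 | A <- flatten ts] G0.
- by move=> b0; apply: irrG; rewrite b0.
- by move=> _ /mapP[A /flattenP[t tts At] ->]; exact: (Hts t tts A At).1.
have [|t tts ty] := sub y; first by apply/words_ltE; rewrite ly lto_succ.
have [A [u [v [At e lu lv Av]]]] := tprod_oomega_tail ly ty.
exists t, A; split => //; have [lA hA] := (words_ltE _ _ _).1 Av.
apply: words_lt_sub => /=; last by rewrite osucc_le -lv.
apply: gen e lu hA; apply/mapP; exists A => //; apply/flattenP.
by exists t.
Qed.

Definition prime_set (S : set (word X)) := forall ts,
  (forall t, t \in ts -> bterm t) -> S `<=` tunion ts ->
  exists2 t, t \in ts & S `<=` tprod t.

Lemma prime_atom B : good_atom B -> prime_set (aset B).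
Proof.
move=> HB ts Hts /(atom_prime HB Hts)[t [A [tts At h]]]; exists t => //.
exact: subset_trans h (tprod_mem (Hts t tts) At).
Qed.

(** For fixed [u] in [S], the second sides of the rectangles whose first side contains [u] cover
    [T], so one of them contains [T]. Hence the first sides of the rectangles whose second side
    contains [T] cover [S], and one contains [S]. *)
Lemma prime_rect S T (rs : seq (seq (set X * Ord) * seq (set X * Ord))) :
  prime_set S -> prime_set T ->
  (forall pr, pr \in rs -> bterm pr.1 /\ bterm pr.2) ->
  (forall u v, S u -> T v -> exists2 pr, pr \in rs & tprod pr.1 u /\ tprod pr.2 v) ->
  exists2 pr, pr \in rs & S `<=` tprod pr.1 /\ T `<=` tprod pr.2.
Proof.
move=> pS pT Hrs H.
have [||t] := pS [seq pr.1 | pr <- rs & `[< T `<=` tprod pr.2 >]].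
- by move=> _ /mapP[pr + ->]; rewrite mem_filter => /andP[_ /Hrs[]].
- move=> u Su.
  have [||t] := pT [seq pr.2 | pr <- rs & `[< tprod pr.1 u >]].
  + by move=> _ /mapP[pr + ->]; rewrite mem_filter => /andP[_ /Hrs[]].
  + move=> v Tv; have [pr prs [h1 h2]] := H u v Su Tv.
    exists pr.2 => //; apply: map_f; rewrite mem_filter prs andbT; exact/asboolP.
  move=> /mapP[pr + ->]; rewrite mem_filter => /andP[/asboolP h1 prs] h2.
  exists pr.1 => //; apply: map_f; rewrite mem_filter prs andbT; exact/asboolP.
move=> /mapP[pr + ->]; rewrite mem_filter => /andP[/asboolP h2 prs] h1.
by exists pr.
Qed.

Definition good t := forall A, A \in t -> good_atom A.

Lemma good_cons A t : good (A :: t) <-> good_atom A /\ good t.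
Proof.
split=> [H|[HA Ht] B]; last by rewrite inE => /predU1P[->|/Ht].
by split=> [|B Bt]; apply: H; rewrite inE ?eqxx // Bt orbT.
Qed.

Lemma good_bterm t : good t -> bterm t.
Proof. by move=> H A /H/good_bound. Qed.

(** The last clause ties each rectangle to one member of [ts], so that a product caught in a single
    rectangle is caught in a single member. *)
Lemma rects_tunion_exist ts : (forall t, t \in ts -> bterm t) ->
  exists rs : seq (seq (set X * Ord) * seq (set X * Ord)),
    (forall pr, pr \in rs -> bterm pr.1 /\ bterm pr.2) /\
    (forall u v, tunion ts (wcat u v) ->
      exists2 pr, pr \in rs & tprod pr.1 u /\ tprod pr.2 v) /\
    (forall pr, pr \in rs -> exists2 t, t \in ts &
      forall u v, tprod pr.1 u -> tprod pr.2 v -> tprod t (wcat u v)).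
Proof.
elim: ts => [_|t ts IH H]; first by exists [::]; split=> //; split=> // u v [].
have [|rs1 [h1 d1]] := @rects_exist t; first by apply: H; exact: mem_head.
have [|rs2 [h2 [d2 e2]]] := IH; first by move=> s ss; apply: H; rewrite inE ss orbT.
exists (rs1 ++ rs2); split; [|split].
- by move=> pr; rewrite mem_cat => /orP[/h1|/h2].
- move=> u v [s]; rewrite inE => /predU1P[->|ss] h.
    by have [pr prs hh] := (d1 u v).1 h; exists pr => //; rewrite mem_cat prs.
  have [|pr prs hh] := d2 u v; first by exists s.
  by exists pr => //; rewrite mem_cat prs orbT.
- move=> pr; rewrite mem_cat => /orP[prs|/e2[s ss hs]].
    exists t; first exact: mem_head.
    by move=> u v hu hv; apply/d1; exists pr.
  by exists s => //; rewrite inE ss orbT.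
Qed.

Lemma prime_tprod p : good p -> prime_set (tprod p).
Proof.
elim: p => [_ ts Hts sub|B r IH /good_cons[HB Hr] ts Hts sub].
  have [|t tts te] := sub (wempty X); first by rewrite tprod_nil.
  by exists t => // w; rewrite tprod_nil => ->.
have [rs [Hrs [Ers Srs]]] := rects_tunion_exist Hts.
have [|pr prs [h1 h2]] := prime_rect (prime_atom HB) (IH Hr) Hrs.
  by move=> u v Bu rv; apply: Ers; apply: sub; apply/tprod_consP; exists u, v.
have [t tts H] := Srs pr prs; exists t => // _ /tprod_consP[u [v [Bu rv ->]]].
by apply: H; [exact: h1|exact: h2].
Qed.

(** * Inclusions between products *)

(** By primality the head [B] and the rest [r] of [p] fit into one rectangle of [A :: q]. If its cut
    is inside [A], the remainder of [A] takes up more of [r] by induction. Otherwise [B] lies in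
    [A], and [p1] is [[:: B]], or in a factor of [x.1], and all of [p] goes into [q]. *)
Lemma tprod_sub_split p A q : good p -> bound_atom A -> bterm q ->
  tprod p `<=` tprod (A :: q) ->
  exists p1 p2, [/\ p = p1 ++ p2, tprod p1 `<=` aset A & tprod p2 `<=` tprod q].
Proof.
elim: p A => [|B r IH] A Hp HA Hq sub.
  exists [::], [::]; split => // w; rewrite tprod_nil => ->; first exact: aset0.
  exact: tprod0.
have /good_cons[HB Hr] := Hp.
have [sp Hsp] := splits_exist HA; have [rs Hrs] := rects_exist Hq.
have [Hc Ec] := is_rects_cons HA Hq Hsp Hrs.
have [u v Bu rv|pr] := prime_rect (prime_atom HB) (prime_tprod Hr) Hc.
  by apply/Ec; apply: sub; apply/tprod_consP; exists u, v.
rewrite mem_cat => /orP[/mapP[x xs ->]|/mapP[x xs ->]] /= [h1 h2].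
  have [HA1 HA2] := Hsp.1 x xs.
  have [r1 [r2 [er h3 h4]]] := IH _ Hr HA2 Hq h2.
  exists (B :: r1), r2; rewrite er; split => //.
  move=> _ /tprod_consP[u [v [Bu rv ->]]]; apply/Hsp.2; exists x => //.
  by split; [rewrite -tprod1; exact: h1|exact: h3].
have [Hx1 Hx2] := Hrs.1 x xs.
have R2q : tprod x.2 `<=` tprod q.
  move=> w hw; rewrite -(wcat0w w); apply/Hrs.2; exists x => //.
  by split => //; exact: tprod0.
have [||t [C [/[!inE] /eqP -> + h]]] := @atom_prime B [:: A :: x.1] HB.
- by move=> _ /[!inE] /eqP ->; exact/bterm_cons.
- by move=> w /h1; exists (A :: x.1); rewrite ?inE.
rewrite inE => /predU1P[eC|Cx].
  exists [:: B], r; split => //; first by rewrite tprod1 -eC.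
  exact: subset_trans h2 R2q.
exists [::], (B :: r); split => //.
  by move=> w; rewrite tprod_nil => ->; exact: aset0.
move=> _ /tprod_consP[u [v [Bu rv ->]]]; apply/Hrs.2; exists x => //.
by split; [exact: (tprod_mem Hx1 Cx (h _ Bu))|exact: h2].
Qed.

Lemma good_atom_gt1 A : good_atom A -> osucc ozero < A.2.
Proof.
move=> [[_ [[b eb] n1] _] _].
have [b0|b0] := eqVneq b ozero.
  case: eb => e; first by case: n1; rewrite e b0.
  by rewrite e b0 oomega0 lto_succ.
by case: eb => ->; [exact: oomega_gt1|exact: lt_trans (oomega_gt1 b0) (lto_succ _)].
Qed.

(** One-letter words recover the base; a constant word of length [B.2] tests the exponent. *)
Lemma aset_sub A B : good_atom A -> aset A `<=` aset B ->
  A.1 `<=` B.1 /\ A.2 <= B.2.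
Proof.
move=> HA sub; have A1 := good_atom_gt1 HA; have [_ [x0 Fx0]] := HA.
split=> [x Ax|].
  have /sub/words_ltE[_] : aset A (wfun (osucc ozero) (fun=> x)) by exact: wfun1_in.
  by rewrite letters_wfun1 ?lto_succ // => h; exact: h.
rewrite leNgt; apply/negP => BA.
have /sub/words_ltE[] : aset A (wfun B.2 (fun=> x0)).
  by apply/words_ltE; split => //; exact: letters_wfun.
by rewrite ltxx.
Qed.

Definition atom_lt A B := [/\ good_atom A, A.1 `<=` B.1, A.2 <= B.2 & A <> B].

End Terms.

(** * Noetherian spaces *)

Section Noetherian.
Variables (X : topologicalType) (hX : noetherian X).

Definition closed_lt (F G : set X) := [/\ closed F, F `<=` G & F <> G].

(** For a strictly descending chain [C], the union [U] of the complements is open, hence compact.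
    The traces of the [C n] on [U] generate a proper filter; a cluster point in [U] lies outside
    some [C n], whose complement is then a neighbourhood missing a set of the filter. *)
Lemma closed_acc F : closed F -> Acc closed_lt F.
Proof.
move=> cF; apply: contrapT => nF.
pose T := {G : set X | closed G /\ ~ Acc closed_lt G}.
have next (G : T) : exists H : T, closed_lt (sval H) (sval G).
  case: G => G [cG nG] /=; apply: contrapT => N; apply: nG; constructor => H HG.
  apply: contrapT => nH; apply: N.
  by exists (exist _ H (conj (let: And3 c _ _ := HG in c) nH)).
have [f Hf] := choice next.
pose C n := sval (iter n f (exist _ F (conj cF nF))).
have C_lt n : closed_lt (C n.+1) (C n) by exact: Hf.
have C_mono m n : (m <= n)%N -> C n `<=` C m.
  elim: n => [|n IH]; first by rewrite leqn0 => /eqP ->.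
  rewrite leq_eqVlt ltnS => /predU1P[-> //|/IH]; apply: subset_trans.
  by case: (C_lt n).
pose U := \bigcup_n (~` C n).
have oU : open U.
  by apply: bigcup_open => n _; apply: closed_openC; exact: (svalP (iter n f _)).1.
pose W n := C n `&` U.
have FW : ProperFilter (filter_from setT W).
  apply: filter_from_proper; first apply: filter_fromT_filter.
  - by exists 0%N.
  - move=> i j; exists (maxn i j) => x [Cx Ux].
    by split; split => //; apply: C_mono Cx; rewrite ?leq_maxl ?leq_maxr.
  - move=> n _; have [_ sub ne] := C_lt n.
    have /existsNP[x /not_implyP[Cx nCx]] : ~ C n `<=` C n.+1.
      by move=> h; apply: ne; apply/seteqP.
    by exists x; split => //; exists n.+1.
have FU : filter_from setT W U by exists 0%N => // x [].
have [p [[n _ nCp] clp]] := hX oU FW FU.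
have [||x [[Cx _]]] := clp (W n) (~` C n); last by apply.
  by exists n.
apply: open_nbhs_nbhs; split => //; apply: closed_openC.
exact: (svalP (iter n f _)).1.
Qed.

(** Noetherian induction: a nonempty reducible [F] is covered by two closed sets not containing it,
    and the decompositions of its intersections with them are joined. *)
Lemma irreducible_decomposition F : closed F ->
  exists2 s : seq (set X), (forall H, H \in s -> irreducible_closed H) &
    F = [set x | exists2 H, H \in s & H x].
Proof.
move=> cF; have acc := closed_acc cF; elim: acc cF => {}F _ IH cF.
have [F0|/eqP/set0P[x0 Fx0]] := pselect (F = set0).
  by exists [::] => //; rewrite F0; apply/seteqP; split => x [].
have [irr|] := pselect (forall F1 F2 : set X, closed F1 -> closed F2 ->
    F `<=` F1 `|` F2 -> F `<=` F1 \/ F `<=` F2).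
  exists [:: F] => [H|]; first by rewrite inE => /eqP ->; split => //; exists x0.
  apply/seteqP; split => x; first by exists F; rewrite ?inE.
  by move=> [H]; rewrite inE => /eqP ->.
move=> /existsNP[F1 /existsNP[F2 /not_implyP[c1 /not_implyP[c2 /not_implyP[sub]]]]].
move=> /not_orP[n1 n2].
have lt G : closed G -> ~ F `<=` G -> closed_lt (F `&` G) F.
  move=> cG nG; split; [exact: closedI|by move=> x []|move=> e; apply: nG].
  by rewrite -e => x [].
have [s1 irr1 e1] := IH _ (lt _ c1 n1) (closedI cF c1).
have [s2 irr2 e2] := IH _ (lt _ c2 n2) (closedI cF c2).
exists (s1 ++ s2) => [H|]; first by rewrite mem_cat => /orP[/irr1|/irr2].
apply/seteqP; split => x.
  move=> Fx; have [h|h] := sub x Fx.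
    have : (F `&` F1) x by split.
    by rewrite e1 => -[H Hs Hx]; exists H => //; rewrite mem_cat Hs.
  have : (F `&` F2) x by split.
  by rewrite e2 => -[H Hs Hx]; exists H => //; rewrite mem_cat Hs orbT.
move=> [H]; rewrite mem_cat => /orP[Hs|Hs] Hx.
  by suff [] : (F `&` F1) x by []; rewrite e1; exists H.
by suff [] : (F `&` F2) x by []; rewrite e2; exists H.
Qed.

Implicit Types (A B : set X * Ord) (p q t : seq (set X * Ord)).

(* The three cases are those where [aset A] is the empty word only, where it
   consists of words of length at most one, and where [A] is a good atom. *)
Lemma bterm_finite_union t : bterm t -> finite_union (@good_atom X) (tprod t).
Proof.
elim: t => [_|A t IH /bterm_cons[[cA bA] /IH Ht]]; first exact: finite_union_tprod.
have trivial_factor : aset A = [set wempty X] -> tprod (A :: t) = tprod t.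
  move=> e; apply/seteqP; split=> w.
    by move=> /tprod_consP[u [v []]]; rewrite e => -> h ->; rewrite wcat0w.
  by move=> h; apply/tprod_consP; exists (wempty X), w; rewrite e wcat0w.
have A0 := bound_gt0 bA.
have [F0|/eqP/set0P[x0 Ax0]] := pselect (A.1 = set0).
  rewrite trivial_factor //; apply/seteqP.
  split=> w; last by move=> ->; exact: words_lt0.
  move=> /words_ltE[_]; rewrite F0 => sub; apply: wlen0; apply/eqP.
  rewrite -[_ == _]negbK -gt0o; apply/negP => /wat_exists[x h].
  by apply: (sub x); apply/lettersP; exists ozero.
have [e1|n1] := pselect (A.2 = oomega ozero).
  rewrite trivial_factor //; apply/seteqP.
  split=> w; last by move=> ->; exact: words_lt0.
  by move=> /words_ltE[]; rewrite e1 oomega0 lt1o => /eqP/wlen0.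
have [e2|n2] := pselect (A.2 = osucc (oomega ozero)); last first.
  have -> : tprod (A :: t) = cat_set (aset A) (tprod t).
    by apply/seteqP; split => w /tprod_consP.
  by apply: finite_union_cons => //; split; last by exists x0.
have [s irr eA] := irreducible_decomposition cA.
have -> : tprod (A :: t) =
    [set w | exists2 H, H \in s & cat_set (aset (H, A.2)) (tprod t) w].
  apply/seteqP; split => w; last first.
    move=> [H Hs [u [v [hu hv ->]]]]; apply/tprod_consP; exists u, v; split => //.
    by apply: words_lt_sub hu => //=; rewrite eA => x Hx; exists H.
  move=> /tprod_consP[u [v [/words_ltE[lu hu] hv ->]]].
  (* As [u] has at most one letter, it lies in one component; if [u] is empty any component serves,
     and there is one since the base is nonempty. *)
  have [H Hs uH] : exists2 H, H \in s & letters u `<=` H.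
    move: lu; rewrite e2 lt_osucc oomega0 => lu.
    have lu0 o x : wat u o x -> o = ozero.
      by move=> h; have := lt_le_trans (wat_lt h) lu; rewrite lt1o => /eqP.
    have [u0|u0] := eqVneq (wlen u) ozero.
      move: Ax0; rewrite eA => -[H Hs _]; exists H => //.
      by rewrite (wlen0 u0) letters0.
    have [x hx] : exists x, wat u ozero x by apply: wat_exists; rewrite gt0o.
    have : A.1 x by apply: hu; apply/lettersP; exists ozero.
    rewrite eA => -[H Hs Hx]; exists H => // y /lettersP[o h].
    by have := h; rewrite (lu0 _ _ h) => /(wat_fun hx) <-.
  by exists H => //; exists u, v; split => //; apply/words_ltE.
apply: finite_union_big => H Hs; apply: finite_union_cons => //.
have irrH := irr H Hs; have [cH H0 _] := irrH.
by split => //; split.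
Qed.

Lemma finite_union_good S :
  finite_union (@bound_atom X) S -> finite_union (@good_atom X) S.
Proof.
move=> [ts Hts ->]; apply: finite_union_big => t tts.
by apply: bterm_finite_union => A; exact: Hts.
Qed.

(** * Well-foundedness of products under inclusion *)

(** Lexicographic induction on the closed set, then on the exponent. *)
Lemma atom_acc A : closed A.1 -> Acc (@atom_lt X) A.
Proof.
case: A => F g /= cF; have acc := closed_acc cF; elim: acc cF g => {}F _ IHF cF g.
elim/lto_induction: g => g IHg; constructor => -[G d] [[[/= cG _ _] _] GF dg ne].
have [e|n] := pselect (G = F); last by apply: IHF.
rewrite e; apply: IHg; rewrite lt_neqAle dg andbT.
by apply/eqP => e'; apply: ne; rewrite e e'.
Qed.

(* The multiset ordering, with all replacements done in place. *)
Inductive refine : seq (set X * Ord) -> seq (set X * Ord) -> Prop :=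
| refine_nil : refine [::] [::]
| refine_same A p q : refine p q -> refine (A :: p) (A :: q)
| refine_lt s A p q : (forall B, B \in s -> atom_lt B A) -> refine p q ->
    refine (s ++ p) (A :: q).

Definition refine_strict p q := refine p q /\ p <> q.

Lemma refine_nilP p : refine p [::] -> p = [::].
Proof. by move=> h; inversion h. Qed.

Lemma refine_consP p A q : refine p (A :: q) ->
  (exists2 r, p = A :: r & refine r q) \/
  (exists s r, [/\ p = s ++ r, forall B, B \in s -> atom_lt B A & refine r q]).
Proof.
by move=> h; inversion h; subst; [left; exists p0|right; exists s, p0].
Qed.

Lemma refine_catP p q1 q2 : refine p (q1 ++ q2) ->
  exists p1 p2, [/\ p = p1 ++ p2, refine p1 q1 & refine p2 q2].
Proof.
elim: q1 p => [|A q1 IH] p /=; first by exists [::], p; split => //; constructor.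
case/refine_consP => [[r -> /IH[p1 [p2 [-> h1 h2]]]]|].
  by exists (A :: p1), p2; split => //; constructor.
move=> [s [r [-> hs /IH[p1 [p2 [-> h1 h2]]]]]].
by exists (s ++ p1), p2; rewrite catA; split => //; constructor.
Qed.

(** Nested induction: a strict refinement splits along the concatenation and is strict on the left
    or, with the left part unchanged, on the right. *)
Lemma refine_acc_cat q1 q2 : Acc refine_strict q1 -> Acc refine_strict q2 ->
  Acc refine_strict (q1 ++ q2).
Proof.
move=> a1; elim: a1 q2 => {}q1 a1 IH1 q2 a2; elim: a2 => {}q2 a2 IH2.
constructor => p [/refine_catP[p1 [p2 [-> h1 h2]]] ne].
have [e1|n1] := pselect (p1 = q1).
  by rewrite e1; apply: IH2; split => // e2; apply: ne; rewrite e1 e2.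
apply: IH1; first by split.
have [->|n2] := pselect (p2 = q2); first by constructor.
by apply: a2; split.
Qed.

(** By concatenation only one-atom lists matter, and a strict refinement of [[:: A]] is a list of
    atoms below [A]. *)
Lemma refine_acc q : (forall A, A \in q -> Acc (@atom_lt X) A) -> Acc refine_strict q.
Proof.
have acc_seq s : (forall A, A \in s -> Acc refine_strict [:: A]) -> Acc refine_strict s.
  elim: s => [_|A s IH H].
    by constructor => p [/refine_nilP ->].
  apply: (@refine_acc_cat [:: A] s); first by apply: H; exact: mem_head.
  by apply: IH => B Bs; apply: H; rewrite inE Bs orbT.
move=> H; apply: (acc_seq) => A /H; elim=> {H} {}A _ IH.
constructor => p [/refine_consP[[r -> /refine_nilP -> //]|]].
move=> [s [r [-> hs /refine_nilP ->]]] _; rewrite cats0.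
by apply: acc_seq => B /hs; exact: IH.
Qed.

(** Split off the part [p1] of [p] inside the first factor [A] of [q]. If [A] occurs in [p1], both
    have the same product and [A] replaces [p1], hence the passage to [p']; otherwise all atoms of
    [p1] are strictly below [A]. *)
Lemma tprod_sub_refine p q : good p -> good q -> tprod p `<=` tprod q ->
  exists p', [/\ good p', tprod p' = tprod p & refine p' q].
Proof.
elim: q p => [|A q IH] p Hp.
  move=> _ sub; exists [::]; split => //; last by constructor.
  apply/seteqP; split => // w; rewrite tprod_nil => ->.
  exact/tprod0/good_bterm.
move=> /good_cons[HA Hq] sub.
have [p1 [p2 [ep sub1 sub2]]] :=
  tprod_sub_split Hp (good_bound HA) (good_bterm Hq) sub.
have Hp1 : good p1 by move=> B B1; apply: Hp; rewrite ep mem_cat B1.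
have [|r [Hr er ref]] := IH p2 _ Hq sub2.
  by move=> B B2; apply: Hp; rewrite ep mem_cat B2 orbT.
have [A1|nA1] := boolP (A \in p1).
  exists (A :: r); split; [exact/good_cons| |exact: refine_same].
  rewrite ep; apply/seteqP; split.
    apply: (@tprod_cat_sub _ [:: A]); rewrite ?er // tprod1.
    exact: tprod_mem (good_bterm Hp1) A1.
  by apply: (@tprod_cat_sub _ _ [:: A]); rewrite ?er // tprod1.
exists (p1 ++ r); split.
- by move=> B; rewrite mem_cat => /orP[/Hp1|/Hr].
- by rewrite ep; apply/seteqP; split; apply: tprod_cat_sub; rewrite ?er.
apply: refine_lt => // B B1.
have [|s1 s2] := aset_sub (Hp1 B B1) (B := A).
  exact: subset_trans (tprod_mem (good_bterm Hp1) B1) sub1.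
split => //; first exact: Hp1.
by move=> e; rewrite -e B1 in nA1.
Qed.

Definition tprod_lt p q := [/\ good p, tprod p `<=` tprod q & tprod p <> tprod q].

Lemma tprod_acc q : good q -> Acc tprod_lt q.
Proof.
move=> Hq; have acc : Acc refine_strict q.
  by apply: refine_acc => A /Hq[[cA _ _] _]; exact: atom_acc.
(* The claim is extended to all presentations of the same set, since the induction hypothesis is
   applied to [p'] in place of [p]. *)
suff : forall r, tprod r = tprod q -> Acc tprod_lt r by apply.
elim: acc Hq => {}q _ IH Hq r er.
constructor => p [Hp sub ne]; rewrite er in sub ne.
have [p' [Hp' ep' ref]] := tprod_sub_refine Hp Hq sub.
apply: (IH p') => //; split => // e; apply: ne.
by rewrite -ep' e.
Qed.

Lemma exists_minimal_tprod (P : seq (set X * Ord) -> Prop) :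
  (exists2 t, good t & P t) ->
  exists t, [/\ good t, P t & forall s, good s -> P s -> tprod s `<=` tprod t ->
    tprod s = tprod t].
Proof.
move=> [t Ht]; have acc := tprod_acc Ht; elim: acc Ht => {}t _ IH Ht Pt.
have [[s [Hs Ps sub ne]]|N] := pselect (exists s, [/\ good s, P s, tprod s `<=` tprod t
    & tprod s <> tprod t]).
  by apply: (IH s).
exists t; split => // s Hs Ps sub; apply: contrapT => ne; apply: N.
by exists s.
Qed.

(** * The regular subword topology *)

Lemma words_prodE n (F : 'I_n -> set X) (g : 'I_n -> Ord) :
  words_prod F g = tprod [seq (F i, g i) | i <- enum 'I_n].
Proof. by rewrite /words_prod /tprod big_map enumT [index_enum _]unlock. Qed.

Section Space.
Variable Y : set (word X).
Local Notation S := (regular_subword Y).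

Definition trace (P : set (word X)) : set S := [set w | P (\val w)].

(** A basic open set is a finite intersection of subbasic ones, so its complement is a finite union
    of subbasic closed sets, each a finite union of good products. *)
Lemma open_basis (U : set S) w : open U -> U w ->
  exists ts, [/\ forall t, t \in ts -> good t, ~ tunion ts (\val w) &
    forall x : S, ~ tunion ts (\val x) -> U x].
Proof.
move=> [D sD <-] [V DV Vw]; have [E sE eV] := sD V DV.
have sub i : i \in enum_fset E -> regular_subbase i.
  by move=> /sE; rewrite inE.
have [ts Hts e] : exists2 ts, (forall t, t \in ts -> good t) &
    forall x : S, tunion ts (\val x) <-> exists2 i, i \in enum_fset E & ~ i x.
  elim: (enum_fset E) sub => [_|i s IH sub].
    by exists [::] => // x; split => -[].
  have [|ts1 H1 e1] := IH; first by move=> j js; apply: sub; rewrite inE js orbT.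
  have [n [F [a [cF ei]]]] := sub i (mem_head _ _).
  have [|ts2 H2 e2] := @finite_union_good (words_prod F a).
    rewrite words_prodE; apply: tprod_finite_union => A /mapP[j _ ->]; exact: cF.
  exists (ts2 ++ ts1) => [t|x].
    by rewrite mem_cat => /orP[tt2 A|/H1 //]; exact: H2.
  have ix : ~ i x <-> tunion ts2 (\val x).
    by rewrite ei -e2; split=> [/contrapT|h] //; apply.
  split=> [[t]|[j]].
    rewrite mem_cat => /orP[tt2|tt1] h.
      by exists i; [exact: mem_head|apply/ix; exists t].
    have [|j js nj] := (e1 x).1; first by exists t.
    by exists j => //; rewrite inE js orbT.
  rewrite inE => /predU1P[->|js] nj.
    by have [t tt2 h] := ix.1 nj; exists t => //; rewrite mem_cat tt2.
  have [|t tt1 h] := (e1 x).2; first by exists j.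
  by exists t => //; rewrite mem_cat tt1 orbT.
exists ts; split => //.
  by move=> /e[i iE]; apply; move: Vw; rewrite -eV; apply.
move=> x nx; suff Vx : V x by exists V.
rewrite -eV => i iE.
by apply: contrapT => ni; apply: nx; apply/e; exists i.
Qed.

Lemma trace_closed n (F : 'I_n -> set X) (g : 'I_n -> Ord) :
  (forall i, closed (F i)) -> closed (trace (words_prod F g)).
Proof.
move=> cF; rewrite -(setCK (trace _)); apply: open_closedC.
exists [set ~` trace (words_prod F g)]; last by rewrite bigcup_set1.
move=> _ ->; apply: (@finI_from1 _ _ _ id).
by exists n, F, g.
Qed.

(* For an ultrafilter, take a minimal product [t] in it, if any: if a subbasic
   closed set [C] belongs to the ultrafilter, then so does one of the products
   that make up the intersection of [t] and [C], hence [t] is included in [C]. *)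
Lemma noetherian_regular_subword : noetherian S.
Proof.
move=> U _; rewrite compact_ultra => G UG GU.
have PG : ProperFilter G by exact: ultra_proper.
have G_union ts : G (trace (tunion ts)) -> exists2 t, t \in ts & G (trace (tprod t)).
  elim: ts => [h|t ts IH h].
    have /filter_ex[x []] := h; by [].
  have [ht|ht] := in_ultra_setVsetC (trace (tprod t)) UG.
    by exists t => //; exact: mem_head.
  have [|s ss hs] := IH; last by exists s => //; rewrite inE ss orbT.
  apply: filterS (filterI h ht) => x [[s]].
  by rewrite inE => /predU1P[->|ss] // hs _; exists s.
have [[t0 Ht0 Gt0]|N] := pselect (exists2 t, good t & G (trace (tprod t))); last first.
  (* If no product is in [G], then no finite union of products is, so [G] contains all basic open
     sets and converges to every point. *)
  have /filter_ex[p Up] := GU; exists p; split => // W.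
  rewrite nbhsE => -[V [oV Vp] VW].
  have [ts [Hts _ sub]] := open_basis oV Vp.
  have [|h] := in_ultra_setVsetC (trace (tunion ts)) UG.
    by move=> /G_union[t tts Gt]; exfalso; apply: N; exists t => //; exact: Hts.
  by apply: filterS h => x /sub/VW.
have [|t [Ht Gt min]] := @exists_minimal_tprod (fun t => G (trace (tprod t))).
  by exists t0.
have /filter_ex[p [Up tp]] : G (U `&` trace (tprod t)) by exact: filterI.
exists p; split => // W.
rewrite nbhsE => -[V [oV Vp] VW].
have [ts [Hts np sub]] := open_basis oV Vp.
have [|h] := in_ultra_setVsetC (trace (tunion ts)) UG; last first.
  by apply: filterS h => x /sub/VW.
move=> /G_union[s sts Gs]; exfalso; apply: np.
have Hs := Hts s sts.
have [rs Hrs e] := finite_union_good (tprodI (good_bterm Ht) (good_bterm Hs)).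
have [|r rrs Gr] := G_union rs.
  by rewrite -e; exact: filterI.
have r_sub : tprod r `<=` tprod t `&` tprod s by rewrite e => w hw; exists r.
exists s => //; apply: (r_sub _ _).2; rewrite (min r) //.
- by move=> A; exact: Hrs.
- by move=> w /r_sub[].
Qed.

Lemma closed_sub_tunion (D : set S) w : closed D -> ~ D w ->
  exists ts, [/\ forall t, t \in ts -> good t, ~ tunion ts (\val w) &
    D `<=` trace (tunion ts)].
Proof.
move=> cD nDw; have [ts [Hts nw sub]] := open_basis (closed_openC cD) nDw.
by exists ts; split => // x Dx; apply: contrapT => /sub.
Qed.

Lemma trace_tprod_closed t : bterm t -> closed (trace (tprod t)).
Proof.
move=> Ht; have -> : tprod t =
    words_prod (fun i => (tnth (in_tuple t) i).1) (fun i => (tnth (in_tuple t) i).2).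
  by rewrite /words_prod /tprod big_tnth.
apply: trace_closed => i.
by have [] := Ht (tnth (in_tuple t) i) (mem_tnth i (in_tuple t)).
Qed.

(** If neither [F1] nor [F2] contained the product, each would lie in a finite union of products
    missing some word of it. By primality a member of one of these unions would contain the whole
    product, that word included. *)
Lemma trace_tprod_irreducible t : good t -> Y (wempty X) -> tprod t `<=` Y ->
  irreducible_closed (trace (tprod t)).
Proof.
move=> Ht Y0 tY; split; first exact: trace_tprod_closed (good_bterm Ht).
  exists (SigSub (mem_set Y0)).
  exact: tprod0 (good_bterm Ht).
move=> F1 F2 c1 c2 sub; apply: contrapT.
move=> /not_orP[/existsNP[w1 /not_implyP[tw1 nw1]] /existsNP[w2 /not_implyP[tw2 nw2]]].
have [ts1 [H1 n1 s1]] := closed_sub_tunion c1 nw1.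
have [ts2 [H2 n2 s2]] := closed_sub_tunion c2 nw2.
have [s|w tw|s] := prime_tprod Ht (ts := ts1 ++ ts2).
- by rewrite mem_cat => /orP[/H1|/H2]; exact: good_bterm.
- have [/s1|/s2] := sub (SigSub (mem_set (tY _ tw))) tw => -[s ss hs];
    by exists s => //; rewrite mem_cat ss ?orbT.
- rewrite mem_cat => /orP[ss|ss] st.
    by apply: n1; exists s => //; exact: st.
  by apply: n2; exists s => //; exact: st.
Qed.

(** Take [t] minimal among the products inside [Y] that contain [D]. For a word of [t] outside [D],
    irreducibility puts [D] in a product [s] missing that word, and then in one of the products
    making up the intersection of [t] and [s], against minimality. *)
Lemma irreducible_tprod (D : set S) t0 : irreducible_closed D -> bterm t0 ->
  tprod t0 = Y -> exists t, [/\ good t, tprod t `<=` Y & D = trace (tprod t)].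
Proof.
move=> irrD Ht0 e0; have [cD _ _] := irrD.
have pick ts : (forall t, t \in ts -> good t) -> D `<=` trace (tunion ts) ->
    exists2 t, t \in ts & D `<=` trace (tprod t).
  move=> Hts sub.
  apply: (@irreducible_seq _ _ _ _ (fun t => trace (tprod t)) irrD) => //.
  by move=> t /Hts/good_bterm; exact: trace_tprod_closed.
have [|t [Ht [Dt tY] min]] :=
  @exists_minimal_tprod (fun t => D `<=` trace (tprod t) /\ tprod t `<=` Y).
  have [ts Hts e] := bterm_finite_union Ht0.
  have [||t tts h] := pick ts.
  - by move=> t tts A; exact: Hts.
  - by move=> x _; rewrite -e e0; exact: set_mem (valP x).
  exists t; first by move=> A; exact: Hts.
  by split => //; rewrite -e0 e => w tw; exists t.
exists t; split => //; apply/seteqP; split => // w tw.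
apply: contrapT => nDw.
have [ts [Hts nw sub]] := closed_sub_tunion cD nDw.
have [s sts Ds] := pick ts Hts sub.
have [rs Hrs e] := finite_union_good (tprodI (good_bterm Ht) (good_bterm (Hts s sts))).
have [||r rrs Dr] := pick rs; first by move=> r rrs A; exact: Hrs.
  by rewrite -e => x Dx; split; [exact: Dt|exact: Ds].
have r_sub : tprod r `<=` tprod t `&` tprod s by rewrite e => x hx; exists r.
apply: nw; exists s => //; apply: (r_sub _ _).2; rewrite (min r) //.
- by move=> A; exact: Hrs.
- by split => // x /r_sub[/tY].
- by move=> x /r_sub[].
Qed.

End Space.

End Noetherian.

(** * Alpha-products as products of bounded word length *)

Section AlphaProducts.
Variable X : topologicalType.
Implicit Types (A B : set X * Ord) (t : seq (set X * Ord)).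

(** An [oomega c] equal to it would exceed [oomega b] and 1 and so, being closed under addition,
    also their sum, which is itself. *)
Lemma osucc_oomega_decomposable b : ~ indecomposable (osucc (oomega b)).
Proof.
move=> [c e]; have bc : oomega b < oomega c by rewrite -e lto_succ.
have c1 : osucc ozero < oomega c.
  by apply: le_lt_trans bc; rewrite osucc_le oomega_gt0.
by have := oomegaD bc c1; rewrite oadd_succ oadd0 e ltxx.
Qed.

Lemma wlen_tprod_lt t b w : (forall A, A \in t -> A.2 <= oomega b) ->
  tprod t w -> wlen w < oomega b.
Proof.
elim: t w => [|A t IH] w H; first by rewrite tprod_nil => ->; exact: oomega_gt0.
move=> /tprod_consP[u [v [/words_ltE[lu _] tv ->]]].
apply: oomegaD; first by apply: lt_le_trans lu _; apply: H; exact: mem_head.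
by apply: IH tv => B Bt; apply: H; rewrite inE Bt orbT.
Qed.

Lemma wlen_tprod_le A0 t b w : (forall A, A \in t -> A.2 <= osucc (oomega b)) ->
  (forall i, (i.+1 < size t)%N -> (nth A0 t i).2 <= oomega b) ->
  tprod t w -> wlen w <= oomega b.
Proof.
elim: t w => [|A t IH] w H1 H2; first by rewrite tprod_nil => -> /=; exact: le0o.
move=> /tprod_consP[u [v [/words_ltE[lu _] tv ->]]].
have [t0|t0] := posnP (size t).
  move: tv; rewrite (size0nil t0) tprod_nil => ->; rewrite wcatw0 -lt_osucc.
  by apply: lt_le_trans lu _; apply: H1; exact: mem_head.
have lu' : wlen u < oomega b.
  by apply: lt_le_trans lu _; apply: (H2 0%N).
rewrite /= -(oadd_oomega lu'); apply: oadd_lel; apply: IH tv.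
  by move=> B Bt; apply: H1; rewrite inE Bt orbT.
by move=> i it; apply: (H2 i.+1).
Qed.

(** For good factors, the conditions on the exponents amount to all words of the product being
    shorter than [a]. *)
Lemma alpha_productP a (P : set (word X)) : is_bound a ->
  alpha_product a P <->
  exists2 t, good t & P = tprod t /\ tprod t `<=` words_lt setT a.
Proof.
move=> ba; split.
  move=> [n [F [g [at_ le_ne lt_ ->]]]]; rewrite words_prodE.
  set t := map _ _; exists t.
    by move=> _ /mapP[i _ ->]; split; [exact: at_|exact: (le_ne i).2].
  split=> // w tw; apply/words_ltE; split => //.
  have le_t A : A \in t -> A.2 <= a.
    by move=> /mapP[i _ ->]; exact: (le_ne i).1.
  case: ba => b [] ea; subst a; first exact: wlen_tprod_lt le_t tw.
  rewrite lt_osucc; apply: (@wlen_tprod_le (setT, ozero) t) => // i.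
  rewrite size_map size_enum_ord => i1.
  have i0 : (i < n)%N by exact: ltnW.
  rewrite (nth_map (Ordinal i0)) ?size_enum_ord // -lt_osucc /=.
  apply: lt_; first exact: osucc_oomega_decomposable.
  by rewrite nth_enum_ord.
move=> [t Ht [-> sub]].
pose T i := tnth (in_tuple t) i.
have HT i : good_atom (T i) by apply: Ht; exact: mem_tnth.
have le_a A : A \in t -> A.2 <= a.
  move=> At; have [|_ ->//] := @aset_sub _ A (setT, a) (Ht A At).
  exact: subset_trans (tprod_mem (good_bterm Ht) At) sub.
exists (size t), (fun i => (T i).1), (fun i => (T i).2); split.
- by move=> i; case: (HT i).
- by move=> i; split; [apply: le_a; exact: mem_tnth|case: (HT i)].
- move=> nd i i1.
  (* If a factor before the last had exponent [a], equal to [osucc (oomega b)], a word of length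
     [oomega b] in it, followed by one letter from the next factor, would have length [a]. *)
  rewrite lt_neqAle le_a ?mem_tnth // andbT; apply/eqP => ei.
  case: ba => b [] ea; first by apply: nd; exists b.
  pose A0 : set X * Ord := (setT, ozero).
  have ti : T i = nth A0 t i by rewrite /T (tnth_nth A0).
  have et : t = take i t ++ nth A0 t i :: nth A0 t i.+1 :: drop i.+2 t.
    by rewrite -!drop_nth ?cat_take_drop //; exact: ltnW.
  set B := nth A0 t i.+1 in et.
  have Bt : B \in t by exact: mem_nth.
  have HB := Ht B Bt; have [_ [y0 By]] := HB; have [_ [x0 Ax]] := HT i.
  set u := wfun (oomega b) (fun=> x0); set v := wfun (osucc ozero) (fun=> y0).
  have Au : aset (T i) u.
    apply/words_ltE; rewrite ei ea lto_succ; split => //; exact: letters_wfun.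
  have Bv : aset B v by apply: wfun1_in => //; exact: good_atom_gt1.
  have /sub/words_ltE[] : tprod t (wcat u v).
    rewrite et; apply/tprod_cat; exists (wempty X), (wcat u v).
    rewrite wcat0w; split => //.
      by apply: tprod0 => A /mem_take; exact: good_bterm.
    apply/tprod_consP; exists u, v; rewrite -ti; split => //.
    by apply: tprod_head => // A /mem_drop; exact: good_bterm.
  by rewrite ea /= oadd_succ oadd0 ltxx.
- by rewrite /words_prod /tprod big_tnth.
Qed.

End AlphaProducts.

Theorem theorem9p3 (X : topologicalType) (hX : noetherian X) :
  (forall Y : set (word X), noetherian (regular_subword Y)) /\
  (forall alpha : Ord, is_bound alpha ->
     forall C : set (word X),
       (exists2 D : set (regular_subword (words_lt (@setT X) alpha)),
          irreducible_closed D & C = [set \val w | w in D])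
       <-> alpha_product alpha C).
Proof.
split=> [Y|a ba C]; first exact: noetherian_regular_subword.
have val_trace t : tprod t `<=` words_lt setT a ->
    [set \val w | w in @trace X (words_lt setT a) (tprod t)] = tprod t.
  move=> sub; apply/seteqP; split=> [_ [w tw <-] //|w tw].
  by exists (SigSub (mem_set (sub w tw))).
rewrite alpha_productP //; split.
  move=> [D irrD ->].
  (* The whole space is the one-factor product [(setT, a)], a bound atom that need not be good, as
     [setT] may be empty or reducible. *)
  have [||t [Ht sub ->]] := irreducible_tprod hX irrD (t0 := [:: (setT, a)]).
  - by apply: bterm1; split => //; exact: closedT.
  - exact: tprod1.
  by exists t => //; rewrite val_trace.
move=> [t Ht [-> sub]]; exists (trace (tprod t)); last by rewrite val_trace.
apply: trace_tprod_irreducible => //.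
exact: words_lt0 (bound_gt0 ba).
Qed.
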